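(* Let $F$ be a free group and let $R$ and $S$ be normal subgroups of $F$. Then there is a natural isomorphism $$\frac{F\cap (1+\mathfrak r\mathfrak f\mathfrak s)}{[R'\cap S',\, R\cap S]\,[R'\cap S,\,R'\cap S]\,[R\cap S',\, R\cap S']}\;\cong\; L_1\mathsf{SP}^2\left(\frac{R\cap S}{(R'\cap S)(R\cap S')}\right).$$
   Context: For a normal subgroup $G$ of $F$, $\mathfrak g$ denotes the two-sided ideal of the integral group ring $\mathbb Z[F]$ generated by $G-1=\{g-1 : g\in G\}$; thus $\mathfrak r,\mathfrak f,\mathfrak s$ are the ideals corresponding to $R,F,S$ (so $\mathfrak f$ is the augmentation ideal), and $\mathfrak r\mathfrak f\mathfrak s$ is their product. For a two-sided ideal $\mathfrak a$ of $\mathbb Z[F]$, $F\cap(1+\mathfrak a)=\{w\in F : w-1\in\mathfrak a\}$, a normal subgroup of $F$. $R'=[R,R]$ and $S'=[S,S]$ are the derived subgroups. For subgroups $A,B$ of $F$, $[A,B]$ is the subgroup generated by all commutators $[a,b]=a^{-1}b^{-1}ab$, $a\in A$, $b\in B$. The denominator on the left is a normal subgroup of $F$ contained in $F\cap(1+\mathfrak r\mathfrak f\mathfrak s)$. For an abelian group $A$, $\mathsf{SP}^2(A)=A\otimes A/\langle a\otimes b-b\otimes a\rangle$ is the symmetric square and $\Lambda^2(A)=A\otimes A/\langle a\otimes a\rangle$ the exterior square (tensor products over $\mathbb Z$). $L_1\mathsf{SP}^2$ is the first derived functor (in the sense of Dold–Puppe, for non-additive functors) of $\mathsf{SP}^2$.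 Concretely, for any free resolution $0\to C\to B\to A\to 0$ of $A$ by free abelian groups (view $C\subseteq B$), $L_1\mathsf{SP}^2(A)$ is the homology at the middle term of the Koszul complex $$0\to\Lambda^2(C)\to C\otimes B\to\mathsf{SP}^2(B),\qquad c\wedge c'\mapsto c\otimes c'-c'\otimes c,\quad c\otimes b\mapsto cb,$$ and this is, up to natural isomorphism, independent of the resolution and functorial in $A$. ''Natural'' means compatible with homomorphisms of free groups $\varphi:F\to\tilde F$ satisfying $\varphi(R)\subseteq\tilde R$ and $\varphi(S)\subseteq\tilde S$, where $\tilde R,\tilde S$ are normal subgroups of $\tilde F$. *)

(* Defs.v *)
From HB Require Import structures.
From mathcomp Require Import finmap.
From mathcomp Require Import monalg.
From mathcomp Require Import all_boot all_algebra.
From mathcomp Require Import boolp classical_sets.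

Set Implicit Arguments.
Unset Strict Implicit.
Unset Printing Implicit Defensive.

Import GRing.Theory.

Local Open Scope classical_set_scope.
Local Open Scope quotient_scope.
Local Open Scope ring_scope.

Identity Coercion set_Funclass : set >-> Funclass.

Definition is_subgroup (G : groupType) (H : set G) : Prop :=
  H 1%g /\ forall x y, H x -> H y -> H (x / y)%g.

Definition is_normal (G : groupType) (H : set G) : Prop :=
  is_subgroup H /\ forall x y, H x -> H (x ^ y)%g.

Record normal_subgroup (G : groupType) := NormalSubgroup {
  nset :> set G;
  nsetP : is_normal nset
}.

Section NormalTheory.
Variables (G : groupType) (H : normal_subgroup G).

Lemma nset1 : H 1%g.
Proof. by case: (nsetP H) => -[]. Qed.

Lemma nsetF x y : H x -> H y -> H (x / y)%g.
Proof. by case: (nsetP H) => -[_ h] _; apply: h. Qed.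

Lemma nsetV x : H x -> H (x^-1)%g.
Proof. by move=> Hx; rewrite -[(x^-1)%g]mul1g; apply: nsetF => //; exact: nset1. Qed.

Lemma nsetM x y : H x -> H y -> H (x * y)%g.
Proof. by move=> Hx Hy; rewrite -[y]invgK; apply: nsetF => //; apply: nsetV. Qed.

Lemma nsetJ x y : H x -> H (x ^ y)%g.
Proof. by case: (nsetP H) => _; apply. Qed.

Lemma nsetRl x y : H x -> H [~ x, y]%g.
Proof. by move=> Hx; apply: nsetM; [apply: nsetV|apply: nsetJ]. Qed.

Lemma nsetRr x y : H y -> H [~ x, y]%g.
Proof.
move=> Hy; rewrite commgEr.
by apply: nsetM => //; apply: nsetJ; apply: nsetV.
Qed.

End NormalTheory.

Section NormalOps.
Variable G : groupType.
Implicit Types H K : normal_subgroup G.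

Fact fullg_normal : is_normal [set: G].
Proof. by []. Qed.

Definition fullg := NormalSubgroup fullg_normal.

Fact capg_normal H K : is_normal (H `&` K).
Proof.
split; first split; first by split; exact: nset1.
- by move=> x y [Hx Kx] [Hy Ky]; split; exact: nsetF.
- by move=> x y [Hx Kx]; split; exact: nsetJ.
Qed.

Definition capg H K := NormalSubgroup (capg_normal H K).

Fact prodg_normal H K :
  is_normal [set z : G | exists x y, [/\ H x, K y & z = (x * y)%g]].
Proof.
split; [split|].
- by exists 1%g, 1%g; rewrite mulg1; split=> //; exact: nset1.
- move=> _ _ [x [y [Hx Ky ->]]] [x' [y' [Hx' Ky' ->]]].
  exists (x / x')%g, ((y / y') ^ (x'^-1))%g; split.
  + exact: nsetF.
  + by apply: nsetJ; exact: nsetF.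
  + by rewrite /conjg invgK invgM !mulgA mulgVK.
- move=> _ z [x [y [Hx Ky ->]]]; exists (x ^ z)%g, (y ^ z)%g.
  by split; [exact: nsetJ|exact: nsetJ|rewrite conjMg].
Qed.

Definition prodg H K := NormalSubgroup (prodg_normal H K).

Fact commsg_normal H K :
  is_normal (smallest (@is_subgroup G)
    [set z : G | exists x y, [/\ H x, K y & z = [~ x, y]%g]]).
Proof.
set X := [set z | _]; have sm : is_subgroup (smallest (@is_subgroup G) X).
  split=> [|x y sx sy] M [sM XM]; first by case: sM.
  by case: (sM) => _; apply; [apply: sx|apply: sy].
split=> // x y; move: x.
suff h : smallest (@is_subgroup G) X
    `<=` [set x | smallest (@is_subgroup G) X (x ^ y)%g] by move=> x /h.
apply: smallest_sub.
- split=> [|u v /=]; first by rewrite /= conj1g; case: sm.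
  by rewrite conjMg conjVg => hu hv; case: sm => _; apply.
- move=> _ [a [b [Ha Kb ->]]] /=; apply: sub_gen_smallest.
  by exists (a ^ y)%g, (b ^ y)%g; split; rewrite ?conjRg//; exact: nsetJ.
Qed.

Definition commsg H K := NormalSubgroup (commsg_normal H K).

Definition derivedg H := commsg H H.

End NormalOps.

Lemma mulf1 (G G' : groupType) (f : {multiplicative G -> G'}) : f 1%g = 1%g.
Proof. by apply: (@mulgI _ (f 1%g)); rewrite -gmulfM !mulg1. Qed.


Section SubgroupType.
Variables (G : groupType) (H : normal_subgroup G).

Definition sgpred : {pred G} := [pred x | `[< H x >]].

Fact sgpred_closed : group_closed sgpred.
Proof.
split=> [|x y]; rewrite !unfold_in; first by apply/asboolP; exact: nset1.
by move=> /asboolP Hx /asboolP Hy; apply/asboolP; exact: nsetF.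
Qed.

Definition subg : Type := {x : G | sgpred x}.

HB.instance Definition _ := SubChoice.on subg.
HB.instance Definition _ := SubChoice_isSubGroup.Build G sgpred subg sgpred_closed.

Lemma subgP (x : subg) : H (val x).
Proof. by have /asboolP := valP x. Qed.

Definition Subg (x : G) (Hx : H x) : subg := Sub x (asboolT Hx).

Lemma val_Subg x (Hx : H x) : val (Subg Hx) = x.
Proof. exact: SubK. Qed.

(** [H `&` K], seen inside [H]. *)
Fact restrictg_normal (K : normal_subgroup G) :
  is_normal [set x : subg | K (val x)].
Proof.
split; first split.
- exact: nset1.
- by move=> x y; exact: nsetF.
- by move=> x y; exact: nsetJ.
Qed.

Definition restrictg (K : normal_subgroup G) :=
  NormalSubgroup (restrictg_normal K).

End SubgroupType.

Section Quotient.
Variables (G : groupType) (N : normal_subgroup G).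

Definition quotg_rel (x y : G) : bool := `[< N (x / y)%g >].

Fact quotg_rel_equiv : equiv_class_of quotg_rel.
Proof.
split=> [x|x y|y x z].
- by apply/asboolP; rewrite mulgV; exact: nset1.
- by apply/asboolP/asboolP => /nsetV; rewrite invgF.
- move=> /asboolP Nxy /asboolP Nyz; apply/asboolP.
  by rewrite -(mulgVK y x) -mulgA; exact: nsetM.
Qed.

Canonical quotg_equiv := EquivRelPack quotg_rel_equiv.
Canonical quotg_encModRel := defaultEncModRel quotg_rel.

Definition quotg : Type := {eq_quot quotg_rel}.
HB.instance Definition _ := Choice.on quotg.
HB.instance Definition _ : EqQuotient G quotg_rel quotg := EqQuotient.on quotg.

Definition cosetg (x : G) : quotg := \pi_quotg x.

Lemma cosetgP x y : cosetg x = cosetg y <-> N (x / y)%g.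
Proof.
split=> [/eqquotP /asboolP //|Nxy]; apply/eqquotP.
by apply/asboolP.
Qed.

Lemma repr_cosetg x : N (repr (cosetg x) / x)%g.
Proof. by apply/cosetgP; rewrite /cosetg reprK. Qed.

Lemma reprgK (u : quotg) : cosetg (repr u) = u.
Proof. exact: reprK. Qed.

Definition quotg_one : quotg := cosetg 1%g.
Definition quotg_mul (u v : quotg) : quotg := cosetg (repr u * repr v)%g.
Definition quotg_inv (u : quotg) : quotg := cosetg ((repr u)^-1)%g.

Lemma quotg_mulE x y : quotg_mul (cosetg x) (cosetg y) = cosetg (x * y)%g.
Proof.
apply/cosetgP; have Nx := repr_cosetg x; have Ny := repr_cosetg y.
set x' := repr _ in Nx *; set y' := repr _ in Ny *.
have -> : (x' * y' / (x * y) = (y' / y) ^ (x'^-1) * (x' / x))%g.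
  by rewrite /conjg invgK invgM !mulgA mulgVK.
by apply: nsetM => //; exact: nsetJ.
Qed.

Lemma quotg_invE x : quotg_inv (cosetg x) = cosetg (x^-1)%g.
Proof.
apply/cosetgP; have Nx := repr_cosetg x; set x' := repr _ in Nx *.
have -> : (x'^-1 / x^-1 = ((x' / x)^-1) ^ x')%g.
  by rewrite /conjg !invgM !invgK !mulgA mulgVK.
by apply: nsetJ; exact: nsetV.
Qed.

Fact quotg_mulA : associative quotg_mul.
Proof.
move=> u v w; rewrite -(reprgK u) -(reprgK v) -(reprgK w).
by rewrite !quotg_mulE mulgA.
Qed.

Fact quotg_mul1 : left_id quotg_one quotg_mul.
Proof. by move=> u; rewrite -(reprgK u) quotg_mulE mul1g. Qed.

Fact quotg_mulr1 : right_id quotg_one quotg_mul.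
Proof. by move=> u; rewrite -(reprgK u) quotg_mulE mulg1. Qed.

Fact quotg_mulV : left_inverse quotg_one quotg_inv quotg_mul.
Proof. by move=> u; rewrite -(reprgK u) quotg_invE quotg_mulE mulVg. Qed.

Fact quotg_mulrV : right_inverse quotg_one quotg_inv quotg_mul.
Proof. by move=> u; rewrite -(reprgK u) quotg_invE quotg_mulE mulgV. Qed.

HB.instance Definition _ := isGroup.Build quotg
  quotg_mulA quotg_mul1 quotg_mulr1 quotg_mulV quotg_mulrV.

Fact cosetg_mul : {morph cosetg : x y / (x * y)%g}.
Proof. by move=> x y; rewrite -quotg_mulE. Qed.

HB.instance Definition _ := isMultiplicative.Build G quotg cosetg cosetg_mul.

End Quotient.

Lemma mulfV (G G' : groupType) (f : {multiplicative G -> G'}) x :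
  f (x^-1)%g = ((f x)^-1)%g.
Proof. by apply: (@mulIg _ (f x)); rewrite -gmulfM !mulVg mulf1. Qed.

Section GroupMaps.

Section SubgMap.
Variables (G G' : groupType) (f : {multiplicative G -> G'}).
Variables (H : normal_subgroup G) (H' : normal_subgroup G').
Hypothesis fH : forall x, H x -> H' (f x).

Definition subg_map (x : subg H) : subg H' := Subg (fH (subgP x)).

Fact subg_map_mul : {morph subg_map : x y / (x * y)%g}.
Proof. by move=> x y; apply: val_inj; rewrite /= gmulfM. Qed.

HB.instance Definition _ :=
  isMultiplicative.Build (subg H) (subg H') subg_map subg_map_mul.
End SubgMap.

Section QuotgMap.
Variables (G G' : groupType) (f : {multiplicative G -> G'}).
Variables (N : normal_subgroup G) (N' : normal_subgroup G').
Hypothesis fN : forall x, N x -> N' (f x).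

Definition quotg_map of (forall x, N x -> N' (f x)) :=
  fun u : quotg N => cosetg N' (f (repr u)).

Lemma quotg_mapE x : quotg_map fN (cosetg N x) = cosetg N' (f x).
Proof.
apply/cosetgP; have := fN (repr_cosetg N x); rewrite gmulfM.
by rewrite mulfV.
Qed.

Fact quotg_map_mul : {morph quotg_map fN : u v / (u * v)%g}.
Proof.
move=> u v; rewrite -(reprgK u) -(reprgK v) -gmulfM !quotg_mapE.
by rewrite -gmulfM -gmulfM.
Qed.

HB.instance Definition _ :=
  isMultiplicative.Build (quotg N) (quotg N') (quotg_map fN) quotg_map_mul.
End QuotgMap.

(** [H / K], as [H / (H `&` K)]; it is only used when [K `<=` H], see
    [rfs_denom_sub] and [meet_denom_sub]. *)
Definition subquot (G : groupType) (H K : normal_subgroup G) : Type :=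
  quotg (restrictg H K).

HB.instance Definition _ (G : groupType) (H K : normal_subgroup G) :=
  Group.on (subquot H K).

Section SubquotMap.
Variables (G G' : groupType) (f : {multiplicative G -> G'}).
Variables (H K : normal_subgroup G) (H' K' : normal_subgroup G').
Hypothesis fH : forall x, H x -> H' (f x).
Hypothesis fK : forall x, K x -> K' (f x).

Fact subquot_map_rel (x : subg H) :
  restrictg H K x -> restrictg H' K' (subg_map fH x).
Proof. exact: fK. Qed.

Definition subquot_map : subquot H K -> subquot H' K' :=
  quotg_map subquot_map_rel.

HB.instance Definition _ :=
  Multiplicative.copy subquot_map (quotg_map subquot_map_rel).

End SubquotMap.

End GroupMaps.

Definition commutative_group (G : groupType) : Prop := commutative (@monoid.mul G).

Section Additive.
Variables (G : groupType) (mulgC : commutative_group G).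

Definition additive_of of commutative_group G : Type := G.

HB.instance Definition _ := Choice.on (additive_of mulgC).
HB.instance Definition _ := GRing.isZmodule.Build (additive_of mulgC)
  (@mulgA G) mulgC (@mul1g G) (@mulVg G).

End Additive.

Section AdditiveMap.
Variables (G G' : groupType) (mulgC : commutative_group G)
  (mulgC' : commutative_group G') (f : {multiplicative G -> G'}).

Definition additive_map : additive_of mulgC -> additive_of mulgC' := f.

Fact additive_map_nmod : nmod_morphism additive_map.
Proof. by split; [exact: mulf1|move=> x y; exact: gmulfM]. Qed.

HB.instance Definition _ := GRing.isNmodMorphism.Build
  (additive_of mulgC) (additive_of mulgC') additive_map
  additive_map_nmod.

End AdditiveMap.

(** Freeness on [B] is the universal property: a map [B -> G] (given by the
    restriction to [B] of some [f : F -> G]) extends uniquely to [F]. *)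
Definition free_basis (F : groupType) (B : set F) : Prop :=
  forall (G : groupType) (f : F -> G),
    exists h : {multiplicative F -> G},
      (forall x, B x -> h x = f x) /\
      (forall h' : {multiplicative F -> G},
         (forall x, B x -> h' x = f x) -> h' =1 h).

Definition free_group (F : groupType) : Prop := exists B : set F, free_basis B.

Section FreeAbelian.
Variables (X : choiceType) (V : zmodType).

(** The additive extension of [f] to [{malg X}], the free abelian group on [X]. *)
Definition zlift (f : X -> V) (u : {malg X}) : V :=
  \sum_(x <- msupp u) f x *~ u@_x.

Lemma zliftEw (f : X -> V) (d : {fset X}) (u : {malg X}) :
  (msupp u `<=` d)%fset -> zlift f u = \sum_(x <- d) f x *~ u@_x.
Proof.
move=> le_ud; rewrite /zlift (big_fset_incl _ le_ud) // => x _.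
by move=> /mcoeff_outdom ->; rewrite mulr0z.
Qed.

Fact zlift_zmod f : zmod_morphism (zlift f).
Proof.
move=> u v; pose d := (msupp u `|` msupp v)%fset.
rewrite (@zliftEw f d u) ?fsubsetUl// (@zliftEw f d v) ?fsubsetUr//.
rewrite (@zliftEw f d) ?msuppB_le// -sumrB.
by apply: eq_bigr => x _; rewrite mcoeffB mulrzBr.
Qed.

HB.instance Definition _ f :=
  GRing.isZmodMorphism.Build {malg X} V (zlift f) (zlift_zmod f).

Lemma zliftU f x : zlift f << x >> = f x.
Proof.
rewrite (zliftEw f (d := [fset x]%fset)) ?msuppU_le//.
by rewrite big_seq_fset1 mcoeffUU.
Qed.

Lemma malg_ind (P : {malg X} -> Prop) :
  P 0 -> (forall x, P << x >>) -> (forall u v, P u -> P v -> P (u - v)) ->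
  forall u, P u.
Proof.
move=> P0 PX PB u.
have PN v : P v -> P (- v) by move=> Pv; rewrite -sub0r; exact: PB.
have PD v w : P v -> P w -> P (v + w).
  by move=> Pv Pw; rewrite -[w]opprK; apply: PB => //; exact: PN.
have PM v n : P v -> P (v *+ n).
  by move=> Pv; elim: n => [|n IHn]; rewrite ?mulr0n// mulrS; exact: PD.
rewrite [u]monalgE; apply: (big_ind P) => // x _.
have -> : << u@_x *g x >> = << x >> *~ u@_x :> {malg X}.
  by rewrite -[in LHS](intz u@_x) raddfMz.
case: (u@_x) => n; first by rewrite -pmulrn; exact: PM.
by rewrite NegzE mulrNz; apply: PN; rewrite -pmulrn; exact: PM.
Qed.

Lemma malg_ext (g h : {additive {malg X} -> V}) :
  (forall x, g << x >> = h << x >>) -> g =1 h.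
Proof.
move=> gh; apply: malg_ind => [|//|u v gu gv]; first by rewrite !raddf0.
by rewrite !raddfB gu gv.
Qed.

End FreeAbelian.

Definition zmap (X Y : choiceType) (f : X -> Y) : {malg X} -> {malg Y} :=
  zlift (fun x => << f x >>).

HB.instance Definition _ (X Y : choiceType) (f : X -> Y) :=
  GRing.Additive.copy (zmap f) (zlift (fun x => << f x >>)).

(** [{malg G}] with the convolution product; the ring structure of [monalg] is
    not available, because it requires a monoid without nontrivial units. *)
Definition group_ring (G : groupType) : Type := {malg G}.

HB.instance Definition _ (G : groupType) :=
  GRing.Zmodule.copy (group_ring G) {malg G}.

Definition gr (G : groupType) (x : G) : group_ring G := << x >>.

HB.lock Definition gr_mul (G : groupType) (u v : group_ring G) : group_ring G :=
  zlift (fun x : G => zlift (fun y : G => gr (x * y)%g) v) u.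

Section GroupRing.
Variable G : groupType.
Implicit Types u v w : group_ring G.

Lemma gr_mulE (x y : G) : gr_mul (gr x) (gr y) = gr (x * y)%g.
Proof. by rewrite gr_mul.unlock /gr !zliftU. Qed.

Lemma gr_mulDl : left_distributive (@gr_mul G) +%R.
Proof. by move=> u v w; rewrite gr_mul.unlock raddfD. Qed.

Lemma gr_mulDr : right_distributive (@gr_mul G) +%R.
Proof.
move=> u v w; rewrite gr_mul.unlock /zlift -big_split; apply: eq_bigr => x _ /=.
by rewrite -mulrzDl -/(zlift _ _) raddfD.
Qed.

Lemma gr_ind (P : group_ring G -> Prop) :
  P 0 -> (forall x, P (gr x)) -> (forall u v, P u -> P v -> P (u - v)) ->
  forall u, P u.
Proof. exact: malg_ind. Qed.

Fact gr_mul0 u : gr_mul u 0 = 0.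
Proof. by apply: (addrI (gr_mul u 0)); rewrite -gr_mulDr !addr0. Qed.

Fact gr_0mul u : gr_mul 0 u = 0.
Proof. by rewrite gr_mul.unlock raddf0. Qed.

Fact gr_mulBr u v w : gr_mul u (v - w) = gr_mul u v - gr_mul u w.
Proof. by apply: (addIr (gr_mul u w)); rewrite -gr_mulDr !subrK. Qed.

Fact gr_mulBl u v w : gr_mul (u - v) w = gr_mul u w - gr_mul v w.
Proof. by rewrite gr_mul.unlock raddfB. Qed.

Fact gr_mulA : associative (@gr_mul G).
Proof.
move=> u v w; move: u v w; apply: gr_ind => [v w|x|u u' IHu IHu' v w].
- by rewrite !gr_0mul.
- apply: gr_ind => [w|y|v v' IHv IHv' w].
  + by rewrite gr_0mul gr_mul0 gr_0mul.
  + apply: gr_ind => [|z|w w' IHw IHw']; first by rewrite !gr_mul0.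
      by rewrite !gr_mulE mulgA.
    by rewrite !gr_mulBr IHw IHw'.
  + by rewrite gr_mulBl !gr_mulBr gr_mulBl IHv IHv'.
- by rewrite !gr_mulBl IHu IHu'.
Qed.

Fact gr_1mul : left_id (gr 1%g) (@gr_mul G).
Proof.
apply: gr_ind => [|x|u v IHu IHv]; first exact: gr_mul0.
  by rewrite gr_mulE mul1g.
by rewrite gr_mulBr IHu IHv.
Qed.

Fact gr_mul1 : right_id (gr 1%g) (@gr_mul G).
Proof.
apply: gr_ind => [|x|u v IHu IHv]; first exact: gr_0mul.
  by rewrite gr_mulE mulg1.
by rewrite gr_mulBl IHu IHv.
Qed.

Fact gr_1neq0 : gr 1%g != 0 :> group_ring G.
Proof. by rewrite monalgU_eq0. Qed.

HB.instance Definition _ := GRing.Zmodule_isNzRing.Build (group_ring G)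
  gr_mulA gr_1mul gr_mul1 gr_mulDl gr_mulDr gr_1neq0.

Lemma grM (x y : G) : gr (x * y)%g = gr x * gr y.
Proof. by rewrite -gr_mulE. Qed.

Lemma gr1 : gr 1%g = 1 :> group_ring G.
Proof. by []. Qed.

End GroupRing.

Lemma mul_sub1C (A : nzRingType) (u v : A) :
  (u - 1) * (v - 1) - (v - 1) * (u - 1) = u * v - v * u.
Proof.
have E (x y : A) : (x - 1) * (y - 1) = x * y - (x + y - 1).
  by rewrite mulrBl mulrBr mulr1 mul1r -addrA -opprD addrA.
rewrite (E u v) (E v u) (addrC v u); move: (u + v - 1) => c.
by rewrite opprB addrA subrK.
Qed.

Definition is_ideal (A : nzRingType) (I : set A) : Prop :=
  [/\ I 0, forall x y, I x -> I y -> I (x - y),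
      forall a x, I x -> I (a * x) & forall a x, I x -> I (x * a)].

Record ideal (A : nzRingType) := Ideal {
  iset :> set A;
  isetP : is_ideal iset
}.

Section IdealTheory.
Variables (A : nzRingType) (I : ideal A).

Lemma iset0 : I 0. Proof. by case: (isetP I). Qed.
Lemma isetB x y : I x -> I y -> I (x - y). Proof. by case: (isetP I) => _ h _ _; apply: h. Qed.
Lemma isetMl a x : I x -> I (a * x). Proof. by case: (isetP I) => _ _ h _; apply: h. Qed.
Lemma isetMr a x : I x -> I (x * a). Proof. by case: (isetP I) => _ _ _; apply. Qed.
Lemma isetN x : I x -> I (- x).
Proof. by move=> Ix; rewrite -sub0r; apply: isetB => //; exact: iset0. Qed.
Lemma isetD x y : I x -> I y -> I (x + y).
Proof. by move=> Ix Iy; rewrite -[y]opprK; apply: isetB => //; exact: isetN. Qed.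

End IdealTheory.

Definition is_addsubgroup (V : zmodType) (H : set V) : Prop :=
  H 0 /\ forall x y, H x -> H y -> H (x - y).

Fact smallest_addsubgroup (V : zmodType) (X : set V) :
  is_addsubgroup (smallest (@is_addsubgroup V) X).
Proof.
split=> [|x y sx sy] M [sM XM]; first by case: sM.
by case: (sM) => _; apply; [apply: sx|apply: sy].
Qed.

Section IdealOps.
Variable A : nzRingType.

Fact ideal_gen_ideal (X : set A) : is_ideal (smallest (@is_ideal A) X).
Proof.
split=> [M [[]]//|x y sx sy M [iM XM]|a x sx M [iM XM]|a x sx M [iM XM]].
- by case: (iM) => _ h _ _; apply: h; [apply: sx|apply: sy].
- by case: (iM) => _ _ h _; apply: h; apply: sx.
- by case: (iM) => _ _ _; apply; apply: sx.
Qed.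

Definition ideal_gen (X : set A) := Ideal (ideal_gen_ideal X).

Fact idealM_ideal (I J : ideal A) :
  is_ideal (smallest (@is_addsubgroup A)
    [set z | exists x y, [/\ I x, J y & z = x * y]]).
Proof.
set X := [set z | _]; have [s0 sB] := smallest_addsubgroup X.
split=> // a.
- suff h : smallest (@is_addsubgroup A) X
      `<=` [set x | smallest (@is_addsubgroup A) X (a * x)] by move=> x /h.
  apply: smallest_sub.
  + by split=> [|x y]; rewrite /= ?mulr0// mulrBr; exact: sB.
  + move=> _ [x [y [Ix Jy ->]]] /=; apply: sub_gen_smallest.
    by exists (a * x), y; split; [exact: isetMl|by []|rewrite mulrA].
- suff h : smallest (@is_addsubgroup A) X
      `<=` [set x | smallest (@is_addsubgroup A) X (x * a)] by move=> x /h.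
  apply: smallest_sub.
  + by split=> [|x y]; rewrite /= ?mul0r// mulrBl; exact: sB.
  + move=> _ [x [y [Ix Jy ->]]] /=; apply: sub_gen_smallest.
    by exists x, (y * a); split; [by []|exact: isetMr|rewrite mulrA].
Qed.

Definition idealM (I J : ideal A) := Ideal (idealM_ideal I J).

End IdealOps.

(** The ideal of [Z[F]] generated by [G - 1]. *)
Definition rel_ideal (F : groupType) (G : normal_subgroup F) :
    ideal (group_ring F) :=
  ideal_gen [set u | exists2 g, G g & u = gr g - 1].

(** The normal subgroup [F cap (1 + a)]. *)
Fact dimg_normal (F : groupType) (a : ideal (group_ring F)) :
  is_normal [set w : F | a (gr w - 1)].
Proof.
split; first split.
- by rewrite /= gr1 subrr; exact: iset0.
- move=> x y /= ax ay.
  have -> : gr (x / y)%g - 1 = (gr x - 1) * gr (y^-1)%g - (gr y - 1) * gr (y^-1)%g.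
    by rewrite !mulrBl !mul1r -!grM mulgV gr1 opprB addrA subrK.
  by apply: isetB; exact: isetMr.
- move=> x y /= ax.
  have -> : gr (x ^ y)%g - 1 = gr (y^-1)%g * ((gr x - 1) * gr y).
    by rewrite mulrBl mul1r mulrBr mulrA -!grM mulVg gr1 conjgE mulgA.
  by apply: isetMl; exact: isetMr.
Qed.

Definition dimg (F : groupType) (a : ideal (group_ring F)) :=
  NormalSubgroup (dimg_normal a).

Section RingMap.
Variables (F F' : groupType) (f : {multiplicative F -> F'}).

Definition gr_map : group_ring F -> group_ring F' := zmap f.

Lemma gr_map_gr x : gr_map (gr x) = gr (f x).
Proof. exact: zliftU. Qed.

Lemma gr_mapB u v : gr_map (u - v) = gr_map u - gr_map v.
Proof. exact: raddfB. Qed.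

Lemma gr_map1 : gr_map 1 = 1.
Proof. by rewrite -!gr1 gr_map_gr mulf1. Qed.

Lemma gr_map0 : gr_map 0 = 0.
Proof. exact: raddf0. Qed.

Lemma gr_mapM u v : gr_map (u * v) = gr_map u * gr_map v.
Proof.
move: u v; apply: gr_ind => [v|x|u u' IHu IHu' v].
- by rewrite mul0r gr_map0 mul0r.
- apply: gr_ind => [|y|v v' IHv IHv']; first by rewrite mulr0 gr_map0 mulr0.
    by rewrite -grM !gr_map_gr gmulfM grM.
  by rewrite mulrBr !gr_mapB mulrBr IHv IHv'.
- by rewrite mulrBl !gr_mapB mulrBl IHu IHu'.
Qed.

Lemma gr_map_rel (G : normal_subgroup F) (G' : normal_subgroup F') :
  (forall x, G x -> G' (f x)) ->
  forall u, rel_ideal G u -> rel_ideal G' (gr_map u).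
Proof.
move=> fG; suff h : rel_ideal G `<=` [set u | rel_ideal G' (gr_map u)] by [].
apply: smallest_sub.
- split=> [|x y|a x|a x]; rewrite /= ?gr_map0 ?gr_mapB ?gr_mapM.
  + exact: (iset0 (rel_ideal G')).
  + exact: (@isetB _ (rel_ideal G')).
  + exact: (@isetMl _ (rel_ideal G')).
  + exact: (@isetMr _ (rel_ideal G')).
- move=> _ [g Gg ->] /=; rewrite gr_mapB gr_map_gr gr_map1.
  by apply: sub_gen_smallest; exists (f g) => //; exact: fG.
Qed.

Lemma gr_map_idealM (I J : ideal (group_ring F)) (I' J' : ideal (group_ring F')) :
  (forall u, I u -> I' (gr_map u)) -> (forall u, J u -> J' (gr_map u)) ->
  forall u, idealM I J u -> idealM I' J' (gr_map u).
Proof.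
move=> fI fJ.
suff h : idealM I J `<=` [set u | idealM I' J' (gr_map u)] by [].
apply: smallest_sub.
- split=> [|x y]; rewrite /= ?gr_map0 ?gr_mapB; [exact: (iset0 (idealM I' J'))|exact: (@isetB _ (idealM I' J'))].
- move=> _ [x [y [Ix Jy ->]]] /=; apply: sub_gen_smallest.
  by exists (gr_map x), (gr_map y); split; [exact: fI|exact: fJ|exact: gr_mapM].
Qed.

Lemma map_dimg (a : ideal (group_ring F)) (a' : ideal (group_ring F')) :
  (forall u, a u -> a' (gr_map u)) -> forall w, dimg a w -> dimg a' (f w).
Proof. by move=> fa w /fa; rewrite gr_mapB gr_map_gr gr_map1. Qed.

Lemma map_capg (H K : normal_subgroup F) (H' K' : normal_subgroup F') :
  (forall x, H x -> H' (f x)) -> (forall x, K x -> K' (f x)) ->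
  forall x, capg H K x -> capg H' K' (f x).
Proof. by move=> fH fK x [/fH Hx /fK Kx]. Qed.

Lemma map_prodg (H K : normal_subgroup F) (H' K' : normal_subgroup F') :
  (forall x, H x -> H' (f x)) -> (forall x, K x -> K' (f x)) ->
  forall x, prodg H K x -> prodg H' K' (f x).
Proof.
move=> fH fK _ [x [y [Hx Ky ->]]]; exists (f x), (f y).
by split; [exact: fH|exact: fK|exact: gmulfM].
Qed.

Lemma map_commsg (H K : normal_subgroup F) (H' K' : normal_subgroup F') :
  (forall x, H x -> H' (f x)) -> (forall x, K x -> K' (f x)) ->
  forall x, commsg H K x -> commsg H' K' (f x).
Proof.
move=> fH fK.
suff h : commsg H K `<=` [set x | commsg H' K' (f x)] by [].
apply: smallest_sub.
- split=> [|x y]; rewrite /= ?mulf1; first exact: (nset1 (commsg H' K')).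
  by rewrite gmulfM mulfV; exact: (@nsetF _ (commsg H' K')).
- move=> _ [x [y [Hx Ky ->]]] /=; apply: sub_gen_smallest.
  exists (f x), (f y); split; [exact: fH|exact: fK|].
  by rewrite /commg /conjg !gmulfM !mulfV.
Qed.

End RingMap.

Section Zquot.
Variables (V : zmodType) (X : set V).

Definition zspan : {pred V} := [pred v | `[< smallest (@is_addsubgroup V) X v >]].

Fact zspan_closed : zmod_closed zspan.
Proof.
have [s0 sB] := smallest_addsubgroup X.
split=> [|x y]; rewrite !unfold_in; first exact/asboolP.
by move=> /asboolP sx /asboolP sy; apply/asboolP; exact: sB.
Qed.

HB.instance Definition _ := GRing.isZmodClosed.Build V zspan zspan_closed.

(** The quotient of [V] by the subgroup generated by [X]. *)
Definition zquot : Type := Quotient.quot zspan.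

HB.instance Definition _ := GRing.Zmodule.on zquot.

Definition zpi (v : V) : zquot := \pi_(Quotient.quot zspan) v.

Fact zpi_zmod : zmod_morphism zpi.
Proof. by move=> u v; exact: (raddfB \pi_(Quotient.quot zspan)). Qed.

HB.instance Definition _ := GRing.isZmodMorphism.Build V zquot zpi zpi_zmod.

Lemma zpiP u v : zpi u = zpi v <-> smallest (@is_addsubgroup V) X (u - v).
Proof.
split=> [/eqP|s]; first by rewrite -Quotient.idealrBE unfold_in => /asboolP.
by apply/eqP; rewrite -Quotient.idealrBE unfold_in; apply/asboolP.
Qed.

Lemma zpi_eq0 x : X x -> zpi x = 0.
Proof.
move=> Xx; rewrite -(raddf0 zpi); apply/zpiP.
by rewrite subr0; exact: sub_gen_smallest.
Qed.

Section Lift.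
Variables (W : zmodType) (g : {additive V -> W}).
Hypothesis gX : forall x, X x -> g x = 0.

Definition zquot_lift of (forall x, X x -> g x = 0) :=
  fun u : zquot => g (repr (u : Quotient.quot zspan)).

Lemma zquot_liftE v : zquot_lift gX (zpi v) = g v.
Proof.
suff h : smallest (@is_addsubgroup V) X `<=` [set v | g v = 0].
  apply/eqP; rewrite -subr_eq0 -raddfB; apply/eqP/h/zpiP.
  by rewrite /zpi reprK.
apply: smallest_sub => //; split=> [|x y]; rewrite /= ?raddf0// raddfB => -> ->.
exact: subr0.
Qed.

Lemma zquotP (u : zquot) : exists v, u = zpi v.
Proof. by exists (repr (u : Quotient.quot zspan)); rewrite /zpi reprK. Qed.

Fact zquot_lift_zmod : zmod_morphism (zquot_lift gX).
Proof.
move=> u v; have [x ->] := zquotP u; have [y ->] := zquotP v.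
by rewrite -raddfB !zquot_liftE raddfB.
Qed.

HB.instance Definition _ :=
  GRing.isZmodMorphism.Build zquot W (zquot_lift gX) zquot_lift_zmod.
End Lift.
End Zquot.

Section Kernel.
Variables (V W : zmodType) (f : {additive V -> W}).

Definition zker : {pred V} := [pred v | f v == 0].

Fact zker_closed : zmod_closed zker.
Proof.
split=> [|x y]; rewrite !unfold_in /= ?raddf0 ?eqxx//.
by rewrite raddfB => /eqP -> /eqP ->; rewrite subr0.
Qed.

HB.instance Definition _ := GRing.isZmodClosed.Build V zker zker_closed.

Definition kernel : Type := {v : V | zker v}.

HB.instance Definition _ := SubChoice.on kernel.
HB.instance Definition _ := [SubChoice_isSubZmodule of kernel by <:].

Lemma kernelP (v : kernel) : f (val v) = 0.
Proof. exact/eqP/(valP v). Qed.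

Definition Kernel v (fv : f v = 0) : kernel := Sub v (introT eqP fv).

End Kernel.

Section KernelMap.
Variables (V W V' W' : zmodType) (f : {additive V -> W}) (f' : {additive V' -> W'}).
Variable g : {additive V -> V'}.
Hypothesis gker : forall v, f v = 0 -> f' (g v) = 0.

Definition kernel_map (v : kernel f) : kernel f' := Kernel (gker (kernelP v)).

Fact kernel_map_zmod : zmod_morphism kernel_map.
Proof. by move=> x y; apply: val_inj; rewrite /= raddfB. Qed.

HB.instance Definition _ := GRing.isZmodMorphism.Build
  (kernel f) (kernel f') kernel_map kernel_map_zmod.
End KernelMap.

Definition tensor_rel (A B : zmodType) : set {malg (A * B)%type} :=
  [set u | exists a a' b, u = << (a + a', b) >> - << (a, b) >> - << (a', b) >>] `|`
  [set u | exists a b b', u = << (a, b + b') >> - << (a, b) >> - << (a, b') >>].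

Definition tensor (A B : zmodType) : Type := zquot (@tensor_rel A B).

HB.instance Definition _ (A B : zmodType) := GRing.Zmodule.on (tensor A B).

Definition tens (A B : zmodType) (a : A) (b : B) : tensor A B :=
  zpi (@tensor_rel A B) << (a, b) >>.

Section Tensor.
Variables A B : zmodType.

Lemma tensDl (a a' : A) (b : B) : tens (a + a') b = tens a b + tens a' b.
Proof.
apply/eqP; rewrite -subr_eq0 opprD addrA -!raddfB; apply/eqP/zpi_eq0.
by left; exists a, a', b.
Qed.

Lemma tensDr (a : A) (b b' : B) : tens a (b + b') = tens a b + tens a b'.
Proof.
apply/eqP; rewrite -subr_eq0 opprD addrA -!raddfB; apply/eqP/zpi_eq0.
by right; exists a, b, b'.
Qed.

Lemma tensor_ext (V : zmodType) (g h : {additive tensor A B -> V}) :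
  (forall a b, g (tens a b) = h (tens a b)) -> g =1 h.
Proof.
move=> gh u; have [v ->] := zquotP u; move: v; apply: malg_ind.
- by rewrite !raddf0.
- by case=> a b; exact: gh.
- by move=> v w gv gw; rewrite !raddfB gv gw.
Qed.

Section Lift.
Variables (V : zmodType) (f : A -> B -> V).
Hypothesis fDl : forall a a' b, f (a + a') b = f a b + f a' b.
Hypothesis fDr : forall a b b', f a (b + b') = f a b + f a b'.

Fact tens_lift_rel u :
  tensor_rel u -> zlift (fun p : A * B => f p.1 p.2) u = 0.
Proof.
case=> -[a [b [c ->]]]; rewrite !raddfB /= !zliftU /=.
  by rewrite fDl addrAC addrK subrr.
by rewrite fDr addrAC addrK subrr.
Qed.

Definition tens_lift : tensor A B -> V :=
  zquot_lift tens_lift_rel.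

HB.instance Definition _ :=
  GRing.Additive.copy tens_lift (zquot_lift tens_lift_rel).

Lemma tens_liftE a b : tens_lift (tens a b) = f a b.
Proof. exact: etrans (zquot_liftE tens_lift_rel _) (zliftU _ _). Qed.
End Lift.
End Tensor.


Section TensMap.
Variables (A B A' B' : zmodType) (f : {additive A -> A'}) (g : {additive B -> B'}).

Fact tens_mapDl a a' b :
  tens (f (a + a')) (g b) = tens (f a) (g b) + tens (f a') (g b).
Proof. by rewrite raddfD tensDl. Qed.

Fact tens_mapDr a b b' :
  tens (f a) (g (b + b')) = tens (f a) (g b) + tens (f a) (g b').
Proof. by rewrite raddfD tensDr. Qed.

Definition tens_map : tensor A B -> tensor A' B' := tens_lift tens_mapDl tens_mapDr.

HB.instance Definition _ :=
  GRing.Additive.copy tens_map (tens_lift tens_mapDl tens_mapDr).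

Lemma tens_mapE a b : tens_map (tens a b) = tens (f a) (g b).
Proof. exact: tens_liftE. Qed.
End TensMap.


Definition sym_rel (A : zmodType) : set (tensor A A) :=
  [set u | exists a b, u = tens a b - tens b a].

Definition SP2 (A : zmodType) : Type := zquot (@sym_rel A).

HB.instance Definition _ (A : zmodType) := GRing.Zmodule.on (SP2 A).

Definition ext_rel (A : zmodType) : set (tensor A A) :=
  [set u | exists a, u = tens a a].

Definition Ext2 (A : zmodType) : Type := zquot (@ext_rel A).

HB.instance Definition _ (A : zmodType) := GRing.Zmodule.on (Ext2 A).

Definition sprod (A : zmodType) (a b : A) : SP2 A := zpi (@sym_rel A) (tens a b).

Definition wedge (A : zmodType) (a b : A) : Ext2 A := zpi (@ext_rel A) (tens a b).

Section Square.
Variable A : zmodType.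

Lemma sprodC (a b : A) : sprod a b = sprod b a.
Proof.
apply/eqP; rewrite -subr_eq0 -raddfB; apply/eqP/zpi_eq0.
by exists a, b.
Qed.

Lemma Ext2_ext (V : zmodType) (g h : {additive Ext2 A -> V}) :
  (forall a b, g (wedge a b) = h (wedge a b)) -> g =1 h.
Proof.
move=> gh u; have [v ->] := zquotP u.
exact: (@tensor_ext _ _ _ (g \o zpi (@ext_rel A)) (h \o zpi (@ext_rel A)) gh v).
Qed.

End Square.

Section SquareMap.
Variables (A B : zmodType) (f : {additive A -> B}).

Fact SP2_map_rel u :
  sym_rel u -> (zpi (@sym_rel B) \o tens_map f f) u = 0.
Proof.
move=> [a [b ->]]; rewrite raddfB /= !tens_mapE.
by apply/eqP; rewrite subr_eq0; apply/eqP; exact: sprodC.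
Qed.

Definition SP2_map : SP2 A -> SP2 B := zquot_lift SP2_map_rel.

HB.instance Definition _ := GRing.Additive.copy SP2_map (zquot_lift SP2_map_rel).

Lemma SP2_mapE a b : SP2_map (sprod a b) = sprod (f a) (f b).
Proof. by rewrite [LHS](zquot_liftE SP2_map_rel) /= tens_mapE. Qed.

Fact Ext2_map_rel u :
  ext_rel u -> (zpi (@ext_rel B) \o tens_map f f) u = 0.
Proof. by move=> [a ->]; rewrite /= tens_mapE; apply: zpi_eq0; exists (f a). Qed.

Definition Ext2_map : Ext2 A -> Ext2 B := zquot_lift Ext2_map_rel.

HB.instance Definition _ := GRing.Additive.copy Ext2_map (zquot_lift Ext2_map_rel).

Lemma Ext2_mapE a b : Ext2_map (wedge a b) = wedge (f a) (f b).
Proof. by rewrite [LHS](zquot_liftE Ext2_map_rel) /= tens_mapE. Qed.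

End SquareMap.


Section Koszul.
Variables (C B : zmodType) (i : {additive C -> B}).

Fact koszul1Dl a a' b :
  sprod (i (a + a')) b = sprod (i a) b + sprod (i a') b.
Proof. by rewrite /sprod raddfD tensDl raddfD. Qed.

Fact koszul1Dr a b b' :
  sprod (i a) (b + b') = sprod (i a) b + sprod (i a) b'.
Proof. by rewrite /sprod tensDr raddfD. Qed.

Definition koszul1 : tensor C B -> SP2 B := tens_lift koszul1Dl koszul1Dr.

HB.instance Definition _ :=
  GRing.Additive.copy koszul1 (tens_lift koszul1Dl koszul1Dr).

Lemma koszul1E c b : koszul1 (tens c b) = sprod (i c) b.
Proof. exact: tens_liftE. Qed.

Fact koszul2Dl c d c' :
  tens (c + d) (i c') - tens c' (i (c + d)) =
  (tens c (i c') - tens c' (i c)) + (tens d (i c') - tens c' (i d)).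
Proof. by rewrite raddfD tensDl tensDr opprD addrACA. Qed.

Fact koszul2Dr c c' d :
  tens c (i (c' + d)) - tens (c' + d) (i c) =
  (tens c (i c') - tens c' (i c)) + (tens c (i d) - tens d (i c)).
Proof. by rewrite raddfD tensDl tensDr opprD addrACA. Qed.

Fact koszul2_rel u : ext_rel u -> tens_lift koszul2Dl koszul2Dr u = 0.
Proof. by move=> [c ->]; rewrite tens_liftE subrr. Qed.

Definition koszul2 : Ext2 C -> tensor C B := zquot_lift koszul2_rel.

HB.instance Definition _ := GRing.Additive.copy koszul2 (zquot_lift koszul2_rel).

Lemma koszul2E c c' : koszul2 (wedge c c') = tens c (i c') - tens c' (i c).
Proof. exact: etrans (zquot_liftE koszul2_rel _) (tens_liftE _ _ _ _). Qed.

Lemma koszul12 w : koszul1 (koszul2 w) = 0.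
Proof.
apply: (@Ext2_ext _ _ (koszul1 \o koszul2) (\0 : {additive _ -> _})) => a b /=.
by rewrite koszul2E raddfB /= !koszul1E sprodC subrr.
Qed.

(** The homology of [Ext2 C -> tensor C B -> SP2 B] at the middle term; it is
    the one of the Koszul complex when [i] is injective, i.e. [C <= B]. *)
Definition koszulH : Type :=
  zquot (V := kernel koszul1) [set z | exists w, val z = koszul2 w].

HB.instance Definition _ := GRing.Zmodule.on koszulH.

End Koszul.

Section KoszulMap.
Variables (C B C' B' : zmodType) (i : {additive C -> B}) (i' : {additive C' -> B'}).
Variables (h : {additive C -> C'}) (g : {additive B -> B'}).
Hypothesis hg : forall c, i' (h c) = g (i c).

Lemma koszul1_nat u : koszul1 i' (tens_map h g u) = SP2_map g (koszul1 i u).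
Proof.
apply: (@tensor_ext _ _ _ (koszul1 i' \o tens_map h g) (SP2_map g \o koszul1 i)).
by move=> a b /=; rewrite tens_mapE !koszul1E SP2_mapE hg.
Qed.

Lemma koszul2_nat w : tens_map h g (koszul2 i w) = koszul2 i' (Ext2_map h w).
Proof.
apply: (@Ext2_ext _ _ (tens_map h g \o koszul2 i) (koszul2 i' \o Ext2_map h)).
by move=> a b /=; rewrite Ext2_mapE !koszul2E raddfB /= !tens_mapE !hg.
Qed.

Fact koszul_ker u : koszul1 i u = 0 -> koszul1 i' (tens_map h g u) = 0.
Proof. by move=> u0; rewrite koszul1_nat u0 raddf0. Qed.

Fact koszul_im (z : kernel (koszul1 i)) : (exists w, val z = koszul2 i w) ->
  (zpi [set z | exists w, val z = koszul2 i' w] \o kernel_map koszul_ker) z = 0.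
Proof.
move=> [w zw]; apply: zpi_eq0; exists (Ext2_map h w).
by rewrite -koszul2_nat /= zw.
Qed.

Definition koszulH_map : koszulH i -> koszulH i' :=
  zquot_lift (X := [set z | exists w, val z = koszul2 i w]) koszul_im.

HB.instance Definition _ := GRing.Additive.copy koszulH_map
  (zquot_lift (X := [set z | exists w, val z = koszul2 i w]) koszul_im).

End KoszulMap.

(** [L_1 SP^2] is computed with the functorial free resolution
    [0 -> kernel -> Z[A] -> A -> 0], where [Z[A]] is free on the set [A]. *)

Definition free_cover (A : zmodType) : {malg A} -> A := zlift id.

HB.instance Definition _ (A : zmodType) :=
  GRing.Additive.copy (@free_cover A) (zlift id).

Definition syzygy (A : zmodType) : Type := kernel (@free_cover A).

HB.instance Definition _ (A : zmodType) := GRing.Zmodule.on (syzygy A).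

Definition syzygy_val (A : zmodType) (c : syzygy A) : {malg A} :=
  val (c : kernel (@free_cover A)).

HB.instance Definition _ (A : zmodType) := GRing.Additive.copy (@syzygy_val A)
  (val : kernel (@free_cover A) -> {malg A}).

Definition L1SP2 (A : zmodType) : Type := koszulH (@syzygy_val A).

HB.instance Definition _ (A : zmodType) := GRing.Zmodule.on (L1SP2 A).

Section L1SP2Map.
Variables (A B : zmodType) (f : {additive A -> B}).

Lemma free_cover_nat u : free_cover (zmap f u) = f (free_cover u).
Proof.
apply: (@malg_ext _ _ (@free_cover B \o zmap f) (f \o @free_cover A)) => a.
by rewrite /= /free_cover /zmap !zliftU.
Qed.

Fact syzygy_ker u : free_cover u = 0 -> free_cover (zmap f u) = 0.
Proof. by rewrite free_cover_nat => ->; rewrite raddf0. Qed.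

Definition syzygy_map : syzygy A -> syzygy B := kernel_map syzygy_ker.

HB.instance Definition _ := GRing.Additive.copy syzygy_map (kernel_map syzygy_ker).

Fact syzygy_map_val c : syzygy_val (syzygy_map c) = zmap f (syzygy_val c).
Proof. by []. Qed.

Definition L1SP2_map : L1SP2 A -> L1SP2 B := koszulH_map syzygy_map_val.

HB.instance Definition _ :=
  GRing.Additive.copy L1SP2_map (koszulH_map syzygy_map_val).

End L1SP2Map.

Section Sides.
Variables (F : groupType) (R S : normal_subgroup F).

Local Notation "''r'" := (rel_ideal R).
Local Notation "''f'" := (rel_ideal (fullg F)).
Local Notation "''s'" := (rel_ideal S).
Local Notation R' := (derivedg R).
Local Notation S' := (derivedg S).

Definition rfs_group : normal_subgroup F := dimg (idealM (idealM 'r 'f) 's).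

Definition rfs_denom : normal_subgroup F :=
  prodg (prodg (commsg (capg R' S') (capg R S))
               (commsg (capg R' S) (capg R' S)))
        (commsg (capg R S') (capg R S')).

Definition rfs_quot : Type := subquot rfs_group rfs_denom.

HB.instance Definition _ := Group.on rfs_quot.

Definition meet_denom : normal_subgroup F := prodg (capg R' S) (capg R S').

Definition meet_quot : Type := subquot (capg R S) meet_denom.

HB.instance Definition _ := Group.on meet_quot.

Lemma rel_ideal_gr (H : normal_subgroup F) x : H x -> rel_ideal H (gr x - 1).
Proof. by move=> Hx; apply: sub_gen_smallest; exists x. Qed.

Lemma idealM_mul (A : nzRingType) (I J : ideal A) u v :
  I u -> J v -> idealM I J (u * v).
Proof. by move=> Iu Jv; apply: sub_gen_smallest; exists u, v. Qed.

Lemma idealM_mulA (A : nzRingType) (I J K : ideal A) u v :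
  I u -> idealM J K v -> idealM (idealM I J) K (u * v).
Proof.
move=> Iu.
suff h : idealM J K `<=` [set v | idealM (idealM I J) K (u * v)] by apply: h.
apply: smallest_sub.
- split=> [|x y]; rewrite /= ?mulr0 ?mulrBr.
    exact: (iset0 (idealM (idealM I J) K)).
  exact: (@isetB _ (idealM (idealM I J) K)).
- move=> _ [x [y [Jx Ky ->]]] /=; rewrite mulrA.
  apply: (@idealM_mul _ (idealM I J) K) => //.
  exact: (@idealM_mul _ I J).
Qed.

Lemma commsg_dimg (H K : normal_subgroup F) (a : ideal (group_ring F)) :
  (forall x y, H x -> K y -> a ((gr x - 1) * (gr y - 1))) ->
  (forall x y, H x -> K y -> a ((gr y - 1) * (gr x - 1))) ->
  commsg H K `<=` dimg a.
Proof.
move=> aHK aKH; apply: smallest_sub; first by case: (dimg_normal a).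
move=> _ [x [y [Hx Ky ->]]] /=.
have -> : gr [~ x, y]%g - 1 = gr (x^-1 * y^-1)%g *
    ((gr x - 1) * (gr y - 1) - (gr y - 1) * (gr x - 1)).
  have -> : (gr x - 1) * (gr y - 1) - (gr y - 1) * (gr x - 1) =
      gr x * gr y - gr y * gr x.
    exact: mul_sub1C.
  by rewrite mulrBr -!grM commgEl conjgE !mulgA mulgVK mulVg gr1.
apply: isetMl; apply: isetB; [exact: aHK|exact: aKH].
Qed.

Lemma derivedg_rf : R' `<=` dimg (idealM 'r 'f).
Proof.
by apply: commsg_dimg => x y Rx Ry;
  apply: idealM_mul; exact: rel_ideal_gr.
Qed.

Lemma derivedg_fs : S' `<=` dimg (idealM 'f 's).
Proof.
by apply: commsg_dimg => x y Rx Ry;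
  apply: idealM_mul; exact: rel_ideal_gr.
Qed.

Lemma rfs_denom_sub : rfs_denom `<=` rfs_group.
Proof.
have rfs x y : R' x -> S y -> idealM (idealM 'r 'f) 's ((gr x - 1) * (gr y - 1)).
  by move=> R'x Sy; apply: idealM_mul; [exact: derivedg_rf|exact: rel_ideal_gr].
have rfs' x y : R x -> S' y -> idealM (idealM 'r 'f) 's ((gr x - 1) * (gr y - 1)).
  by move=> Rx S'y; apply: idealM_mulA; [exact: rel_ideal_gr|exact: derivedg_fs].
move=> _ [_ [z [[x [y [hx hy ->]]] hz ->]]].
have hx' : rfs_group x.
  by move: x hx; apply: commsg_dimg => x t [R'x S'x] [Rt St]; [exact: rfs|exact: rfs'].
have hy' : rfs_group y.
  by move: y hy; apply: commsg_dimg => y t [R'y Sy] [R't St]; exact: rfs.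
have hz' : rfs_group z.
  by move: z hz; apply: commsg_dimg => z t [Rz S'z] [Rt S't]; exact: rfs'.
by apply: nsetM => //; exact: nsetM.
Qed.

Lemma meet_denom_sub : meet_denom `<=` capg R S.
Proof.
have sub (H : normal_subgroup F) : derivedg H `<=` H.
  apply: smallest_sub; first by case: (nsetP H).
  by move=> _ [x [y [Hx Hy ->]]]; exact: nsetRl.
move=> _ [x [y [[R'x Sx] [Ry S'y] ->]]].
by split; apply: nsetM => //; exact: sub.
Qed.

Fact meet_quot_comm : commutative_group meet_quot.
Proof.
move=> u v; rewrite -(reprgK u) -(reprgK v) -!gmulfM; apply/cosetgP => /=.
set x := val _; set y := val _.
have [Rx Sx] : capg R S x by exact: subgP.
have [Ry Sy] : capg R S y by exact: subgP.
exists (x * y / (y * x))%g, 1%g; split; [|exact: (nset1 (capg R S'))|by rewrite mulg1].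
have -> : (x * y / (y * x) = [~ x^-1, y^-1])%g.
  by rewrite /commg /conjg !invgK invgM !mulgA.
split; last by apply: nsetRl; exact: nsetV.
apply: (@sub_gen_smallest F (@is_subgroup F)).
by exists (x^-1)%g, (y^-1)%g; split=> //; exact: nsetV.
Qed.

Definition meet_ab : Type := additive_of meet_quot_comm.

HB.instance Definition _ := GRing.Zmodule.on meet_ab.

End Sides.

Section SideMaps.
Variables (F1 F2 : groupType) (phi : {multiplicative F1 -> F2}).
Variables (R1 S1 : normal_subgroup F1) (R2 S2 : normal_subgroup F2).
Hypothesis phiR : forall x, R1 x -> R2 (phi x).
Hypothesis phiS : forall x, S1 x -> S2 (phi x).

Let phiR' : forall x, derivedg R1 x -> derivedg R2 (phi x).
Proof. exact: map_commsg. Qed.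

Let phiS' : forall x, derivedg S1 x -> derivedg S2 (phi x).
Proof. exact: map_commsg. Qed.

Fact map_rfs_group x : rfs_group R1 S1 x -> rfs_group R2 S2 (phi x).
Proof.
apply: map_dimg; apply: gr_map_idealM; last exact: gr_map_rel.
by apply: gr_map_idealM; apply: gr_map_rel.
Qed.

Fact map_rfs_denom x : rfs_denom R1 S1 x -> rfs_denom R2 S2 (phi x).
Proof.
apply: map_prodg; last by apply: map_commsg; exact: map_capg.
by apply: map_prodg; apply: map_commsg; exact: map_capg.
Qed.

Definition rfs_quot_map : rfs_quot R1 S1 -> rfs_quot R2 S2 :=
  subquot_map map_rfs_group map_rfs_denom.

Fact map_meet_denom x : meet_denom R1 S1 x -> meet_denom R2 S2 (phi x).
Proof. by apply: map_prodg; exact: map_capg. Qed.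

Definition meet_ab_map : meet_ab R1 S1 -> meet_ab R2 S2 :=
  @additive_map _ _ (@meet_quot_comm F1 R1 S1) (@meet_quot_comm F2 R2 S2)
    (subquot_map (map_capg phiR phiS) map_meet_denom).

HB.instance Definition _ := GRing.Additive.copy meet_ab_map
  (@additive_map _ _ (@meet_quot_comm F1 R1 S1) (@meet_quot_comm F2 R2 S2)
    (subquot_map (map_capg phiR phiS) map_meet_denom)).

End SideMaps.

(* Main.v *)
(** Put [T = R cap S] and [P = T / (R' cap S')], and let [U], [V] be the images
    in [P] of [R' cap S] and [R cap S'], i.e. the kernels of [P -> Rab] and
    [P -> Sab]; thus [U cap V = 0] and [D = P / (U + V)] is the group on the
    right-hand side.  All these groups are free abelian, hence projective.

    Since [rs / rfs = Rab (x) Sab] and [F cap (1 + rs) = T'], and since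
    [a, b |-> a (x) b - b (x) a] induces a homomorphism [kappa : T' -> P (x) P]
    because [T] is free, [F cap (1 + rfs)] is the set of the [w] in [T'] with
    [kappa w] in the kernel of [P (x) P -> Rab (x) Sab].  The denominator
    consists of the [w] with [kappa w] in the span [B] of the tensors
    [u (x) u' - u' (x) u] and [v (x) v' - v' (x) v], [u, u'] in [U], [v, v'] in [V].

    On the other side, [U + V -> P] is a resolution of [D], and the map
    [(u + v) (x) x |-> u (x) x + x (x) v] embeds its Koszul homology at
    [(U + V) (x) P] in [(P (x) P) / B], with the same image as [kappa]. *)
Require Import Defs.
From HB Require Import structures.
From mathcomp Require Import finmap.
From mathcomp Require Import monalg.
From mathcomp Require Import all_boot all_algebra.
From mathcomp Require Import boolp classical_sets.
From mathcomp Require wochoice.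

Set Implicit Arguments.
Unset Strict Implicit.
Unset Printing Implicit Defensive.

Import GRing.Theory.
Local Open Scope classical_set_scope.
Local Open Scope ring_scope.

(** Freeness of subgroups is used without bases, through one lifting property, [normal_lift]. In the
    same spirit [projective] asks for a section of the canonical cover by [{malg A}], a condition
    that passes to products and subgroups.

    The isomorphism of r s / r f s with Rab (x) Sab is never built. From outside, r f s is detected
    by functions on [F] whose mixed difference at [w], [g], [y] does not depend on [g]; from inside,
    the classes of (w - 1)(y - 1) are bilinear modulo r f s.

    L_1 SP^2 is defined by the resolution with basis the set [D], while the computation lives on U +
    V -> P. As SP^2 is not additive, the comparison needs a homotopy with a quadratic term; the same
    homotopy removes the dependence on chosen lifts and so gives naturality. *)

Section AdditiveOfMorph.
Variables (V W : zmodType) (f : V -> W) (fD : {morph f : x y / x + y}).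

Definition addmor of {morph f : x y / x + y} : V -> W := f.

Fact addmor_zmod : zmod_morphism (addmor fD).
Proof.
by move=> x y; apply: (addIr (f y)); rewrite /addmor subrK -fD subrK.
Qed.

HB.instance Definition _ :=
  GRing.isZmodMorphism.Build V W (addmor fD) addmor_zmod.
End AdditiveOfMorph.

(** * Projective abelian groups *)

Definition projective (A : zmodType) :=
  exists s : {additive A -> {malg A}}, cancel s (@free_cover A).

Lemma projective_lift (A B C : zmodType) (f : {additive B -> C})
    (g : {additive A -> C}) :
  projective A -> (forall a, exists b, f b = g a) ->
  exists h : {additive A -> B}, forall a, f (h a) = g a.
Proof.
move=> [s sK] /choice[t ft]; exists (zlift t \o s) => a /=.
rewrite -[in RHS](sK a).
apply: (@malg_ext _ _ (f \o zlift t) (g \o @free_cover A)) => x /=.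
by rewrite /free_cover !zliftU.
Qed.

Lemma projective_retract (A : zmodType) (X : choiceType)
    (i : {additive A -> {malg X}}) (r : {additive {malg X} -> A}) :
  cancel i r -> projective A.
Proof.
move=> iK; exists (zlift (fun x => << r << x >> >>) \o i) => a /=.
rewrite -[RHS]iK.
apply: (@malg_ext _ _ (@free_cover A \o zlift (fun x => << r << x >> >>)) r) => x /=.
by rewrite /free_cover !zliftU.
Qed.

Lemma projective_malg (X : choiceType) : projective {malg X}.
Proof.
exact: (@projective_retract _ X (idfun : {additive _ -> _})
  (idfun : {additive _ -> _})).
Qed.

Lemma projective_prod (A B : zmodType) :
  projective A -> projective B -> projective (A * B)%type.
Proof.
move=> [s sK] [t tK].
pose inl a : A * B := (a, 0); pose inr b : A * B := (0, b).
have inlD : {morph inl : x y / x + y} by move=> x y; congr pair; rewrite addr0.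
have inrD : {morph inr : x y / x + y} by move=> x y; congr pair; rewrite addr0.
pose f (u : A * B) : {malg (A * B)%type} := zmap inl (s u.1) + zmap inr (t u.2).
have fD : {morph f : x y / x + y}.
  by move=> x y; rewrite /f !raddfD addrACA.
exists (addmor fD) => -[a b]; rewrite /addmor /f raddfD /=.
rewrite (free_cover_nat (addmor inlD)) (free_cover_nat (addmor inrD)) sK tK.
by congr pair; rewrite ?addr0 ?add0r.
Qed.

(** * Well-orders and subgroups of free abelian groups *)

Section WellOrder.
Variables (X : eqType) (R : rel X).
Hypothesis woR : wochoice.well_order R.

Lemma well_order_min (A : set X) : (exists x, A x) ->
  exists2 x, A x & forall y, A y -> R x y.
Proof.
move=> [x Ax]; case: (@woR [pred x | `[< A x >]]).
  by exists x; apply/asboolP.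
move=> z [[/asboolP Az zmin] _]; exists z => // y Ay.
by apply: zmin; apply/asboolP.
Qed.

Lemma well_order_total : total R.
Proof.
move=> x y; have [|z [-> h|-> h]] := @well_order_min [set z | z = x \/ z = y].
- by exists x; left.
- by rewrite h //; right.
- by rewrite (h x) ?orbT //; left.
Qed.

Lemma well_order_anti : antisymmetric R.
Proof.
move=> x y /andP[Rxy Ryx].
have [|z [_ zuniq]] := @woR [pred z | (z == x) || (z == y)].
  by exists x; rewrite inE eqxx.
have Rr a : R a a by move: (well_order_total a a); rewrite orbb.
rewrite -(zuniq x); last first.
  split; first by rewrite inE eqxx.
  by move=> w; rewrite inE => /orP[] /eqP ->.
apply: zuniq; split; first by rewrite inE eqxx orbT.
by move=> w; rewrite inE => /orP[] /eqP ->.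
Qed.

Lemma well_order_trans : transitive R.
Proof.
move=> y x z Rxy Ryz.
have [|m mP mmin] := @well_order_min [set w | [\/ w = x, w = y | w = z]].
  by exists x; apply: Or31.
have Rmx : R m x by apply: mmin; apply: Or31.
have Rmy : R m y by apply: mmin; apply: Or32.
have Rmz : R m z by apply: mmin; apply: Or33.
case: mP => mE; rewrite mE in Rmx Rmy Rmz => //.
  by rewrite (@well_order_anti x y) ?Rxy.
by rewrite -(@well_order_anti y z) ?Ryz.
Qed.

Lemma well_order_max (s : seq X) : s != [::] ->
  exists2 x, x \in s & forall y, y \in s -> R y x.
Proof.
have Rr a : R a a by move: (well_order_total a a); rewrite orbb.
elim: s => // a s IHs _; case: (eqVneq s [::]) => [->|/IHs[x xs xmax]].
  by exists a; rewrite ?inE// => y; rewrite inE => /eqP ->.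
have [Rax|Rxa] := orP (well_order_total a x).
  exists x; first by rewrite inE xs orbT.
  by move=> y; rewrite inE => /orP[/eqP ->//|/xmax].
exists a; first by rewrite inE eqxx.
move=> y; rewrite inE => /orP[/eqP ->//|/xmax Ryx].
exact: well_order_trans Ryx Rxa.
Qed.

End WellOrder.

Lemma malg_max (X : choiceType) (R : rel X) (u : {malg X}) :
  wochoice.well_order R -> u != 0 ->
  exists2 x, u@_x != 0 & forall y, u@_y != 0 -> R y x.
Proof.
move=> woR u0.
have [|x xu xmax] := @well_order_max _ _ woR (msupp u).
  apply: contraNneq u0 => su; apply/eqP/malgP => y; rewrite mcoeff0; apply: mcoeff_outdom.
  by rewrite -[y \in msupp u]/(y \in (msupp u : seq X)) su.
by exists x => [|y]; rewrite mcoeff_neq0 // => /xmax.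
Qed.

(** A subgroup of a free abelian group is free on elements [g x] of least
    leading coefficient among those with leading index [x]. *)
Lemma projective_sub_malg (N : zmodType) (X : choiceType)
    (j : {additive N -> {malg X}}) : injective j -> projective N.
Proof.
move=> j_inj.
have [R woR] := wochoice.well_ordering_principle X.
have Ranti := well_order_anti woR.
pose below x n := forall y, (j n)@_y != 0 -> R y x.
have belowB x n n' k : below x n -> below x n' -> below x (n - n' *~ k).
  move=> bn bn' y; rewrite raddfB raddfMz mcoeffB raddfMz /=.
  case: (eqVneq (j n)@_y 0) => [->|/bn //].
  by case: (eqVneq (j n')@_y 0) => [->|/bn' //]; rewrite mul0rz subrr eqxx.
have j0 n : j n = 0 -> n = 0 by move=> jn; apply: j_inj; rewrite jn raddf0.
(* [n0] has the least nonzero absolute coefficient at [x] among the elements below [x], or is [0] if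
   all these coefficients vanish. The second clause is Euclidean division: a nonzero remainder would
   be smaller. *)
have /choice[g gP] x : exists n0, [/\ below x n0,
    forall n, below x n -> exists k : int, (j n)@_x = k * (j n0)@_x &
    (j n0)@_x = 0 -> n0 = 0].
  pose P m := `[< exists n, [/\ below x n, (j n)@_x != 0 & `|(j n)@_x|%N = m] >].
  have [[m Pm]|noP] := pselect (exists m, P m); last first.
    exists 0; split=> // [y|n bn]; first by rewrite raddf0 mcoeff0 eqxx.
    exists 0; rewrite mul0r; apply/eqP/negPn/negP => nx0; apply: noP.
    by exists `|(j n)@_x|%N; apply/asboolP; exists n.
  case: (ex_minnP (ex_intro _ m Pm)) => {Pm}m /asboolP[n0 [b0 c0 c0m] mmin].
  exists n0; split=> // [n bn|/eqP]; last by rewrite (negPf c0).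
  exists ((j n)@_x %/ (j n0)@_x)%Z.
  apply/eqP; rewrite -subr_eq0; apply/negPn/negP => r0.
  have cE : (j (n - n0 *~ ((j n)@_x %/ (j n0)@_x)%Z))@_x =
      ((j n)@_x %% (j n0)@_x)%Z.
    rewrite raddfB raddfMz mcoeffB raddfMz /= -mulrzr intz mulrC.
    by rewrite [X in X - _](divz_eq _ (j n0)@_x) addrC addKr.
  have : (m <= `|((j n)@_x %% (j n0)@_x)%Z|)%N.
    apply: mmin; apply/asboolP; exists (n - n0 *~ ((j n)@_x %/ (j n0)@_x)%Z).
    by rewrite cE; split=> //; exact: belowB.
  have := ltz_mod (j n)@_x c0; have := modz_ge0 (j n)@_x c0.
  rewrite -c0m; case: ((j n)@_x %% (j n0)@_x)%Z => // a _.
  by rewrite -abszE ltz_nat absz_nat => lt1 /(leq_trans lt1); rewrite ltnn.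
pose r : {additive {malg X} -> N} := zlift g.
(* The basis of [N] consists of the nonzero [g x]: [r] is bijective on the combinations supported
   there. Injectivity is read at the leading index [x], since [j (g y)] has no coefficient at [x]
   when [y] is smaller. *)
pose good (u : {malg X}) := forall x, u@_x != 0 -> g x != 0.
have goodB u v : good u -> good v -> good (u - v).
  move=> gu gv x; rewrite mcoeffB; case: (eqVneq u@_x 0) => [->|/gu //].
  by case: (eqVneq v@_x 0) => [->|/gv //]; rewrite subrr eqxx.
have r_inj u : good u -> r u = 0 -> u = 0.
  move=> gu ru; apply/eqP/negPn/negP => u0.
  have [x ux xmax] := malg_max woR u0.
  have [gb _ gx0] := gP x.
  have : (j (r u))@_x = (j (g x))@_x * u@_x.
    rewrite /r /= /zlift !raddf_sum (bigD1_seq x) ?fset_uniq //=;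
      last by rewrite -[_ \in _]/(x \in msupp u) -mcoeff_neq0.
    rewrite big1_seq ?addr0 => [|y /andP[yx yu]].
      by rewrite !raddfMz -mulrzr intz.
    rewrite !raddfMz /=; have [yb _ _] := gP y.
    case: (eqVneq (j (g y))@_x 0) => [->|/yb Rxy]; first by rewrite mul0rz.
    move: yx; rewrite (Ranti x y) ?eqxx// Rxy xmax// mcoeff_neq0.
    exact: yu.
  rewrite ru raddf0 mcoeff0 => /esym/eqP; rewrite mulf_eq0 (negPf ux) orbF.
  by move=> /eqP/gx0/eqP; rewrite (negPf (gu x ux)).
have r_surj n : exists2 u, good u & r u = n.
  have good0 : good 0 by move=> x; rewrite mcoeff0 eqxx.
  suff h x : forall n, below x n -> exists2 u, good u & r u = n.
    case: (eqVneq (j n) 0) => [/j0 ->|jn]; first by exists 0; [exact: good0|exact: raddf0].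
    by have [x _ /h] := malg_max woR jn.
  apply: contrapT => nh.
  pose bad := [set x | ~ forall n, below x n -> exists2 u, good u & r u = n].
  (* At a least bad [x], subtracting a multiple of [g x] clears the coefficient at [x], so the new
     leading index is strictly smaller and not bad. *)
  have [|{nh}x badx xmin] := @well_order_min _ _ woR bad; first by exists x.
  apply: badx => {}n bn; have [gb gk gx0] := gP x; have [k nk] := gk _ bn.
  have nx : (j (n - g x *~ k))@_x = 0.
    by rewrite raddfB raddfMz mcoeffB raddfMz /= nk -mulrzr intz mulrC subrr.
  have [u gu ru] : exists2 u, good u & r u = n - g x *~ k.
    case: (eqVneq (j (n - g x *~ k)) 0) => [/j0 ->|jn].
      by exists 0; [exact: good0|exact: raddf0].
    have [y yn ymax] := malg_max woR jn.
    have Ryx : R y x by exact: (belowB x n (g x) k bn gb).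
    have /contrapT : ~ bad y.
      move=> /xmin Rxy; move: yn; rewrite (Ranti y x) ?Ryx ?Rxy//.
      by rewrite nx eqxx.
    exact.
  exists (u - (if g x == 0 then 0 else << x >> *~ (- k))); last first.
    rewrite raddfB ru; case: eqP => [->|_]; first by rewrite mul0rz !raddf0 !addr0.
    by rewrite [r _]raddfMz /r /= zliftU mulrNz opprK subrK.
  apply: goodB => //; case: ifPn => [_|gxn0]; first exact: good0.
  move=> y; rewrite raddfMz /= mcoeffU; case: (eqVneq x y) => [<- //|_].
  by rewrite mulr0n mul0rz eqxx.
have /choice[i iP] n : exists u, good u /\ r u = n.
  by have [u gu ru] := r_surj n; exists u.
have iD : {morph i : x y / x + y}.
  move=> m n; apply/eqP; rewrite -subr_eq0 opprD addrA; apply/eqP/r_inj.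
    by apply/goodB; [apply/goodB|]; case: (iP n); case: (iP m); case: (iP (m + n)).
  rewrite !raddfB /=; have [_ ->] := iP (m + n); have [_ ->] := iP m.
  by have [_ ->] := iP n; rewrite addrAC addrK subrr.
apply: (@projective_retract _ _ (addmor iD) r) => n.
by have [] := iP n.
Qed.

Lemma projective_sub (N A : zmodType) (j : {additive N -> A}) :
  projective A -> injective j -> projective N.
Proof.
move=> [s sK] j_inj; apply: (@projective_sub_malg _ _ (s \o j)).
by apply: inj_comp => //; exact: can_inj sK.
Qed.

(** * Tensor products: flatness and antisymmetric tensors *)

Section TensorLemmas.
Variables A B : zmodType.
Implicit Types (a : A) (b : B).

Lemma tens0l b : tens 0 b = 0 :> tensor A B.
Proof. by apply: (addrI (tens (0 : A) b)); rewrite -tensDl !addr0. Qed.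

Lemma tens0r a : tens a 0 = 0 :> tensor A B.
Proof. by apply: (addrI (tens a (0 : B))); rewrite -tensDr !addr0. Qed.

Lemma tensBl a a' b : tens (a - a') b = tens a b - tens a' b.
Proof. by apply: (addIr (tens a' b)); rewrite -tensDl !subrK. Qed.

Lemma tensBr a b b' : tens a (b - b') = tens a b - tens a b'.
Proof. by apply: (addIr (tens a b')); rewrite -tensDr !subrK. Qed.

Lemma tensor_ind (Pt : tensor A B -> Prop) :
  Pt 0 -> (forall a b, Pt (tens a b)) -> (forall t u, Pt t -> Pt u -> Pt (t - u)) ->
  forall t, Pt t.
Proof.
move=> P0 Pgen PB t; have [u ->] := zquotP t; move: u; apply: malg_ind.
- by rewrite raddf0.
- by case=> a b; exact: Pgen.
- by move=> u v Pu Pv; rewrite raddfB; exact: PB.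
Qed.

End TensorLemmas.

Lemma zpi_eq0P (V : zmodType) (X : set V) v :
  is_addsubgroup X -> zpi X v = 0 -> X v.
Proof.
move=> sX; rewrite -(raddf0 (zpi X)) => /zpiP; rewrite subr0.
by apply: smallest_sub.
Qed.

Lemma zlift_addf (X : choiceType) (V : zmodType) (f g : X -> V) u :
  zlift (fun x => f x + g x) u = zlift f u + zlift g u.
Proof. by rewrite /zlift -big_split; apply: eq_bigr => x _ /=; rewrite mulrzDl. Qed.

Section Flat.
Variables (A : zmodType) (X : choiceType).

Fact tens_coefDl x (a a' : A) (v : {malg X}) :
  (a + a') *~ v@_x = a *~ v@_x + a' *~ v@_x.
Proof. exact: mulrzDl. Qed.

Fact tens_coefDr x (a : A) (v v' : {malg X}) :
  a *~ (v + v')@_x = a *~ v@_x + a *~ v'@_x.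
Proof. by rewrite mcoeffD mulrzDr. Qed.

Definition tens_coef x : tensor A {malg X} -> A :=
  tens_lift (tens_coefDl x) (tens_coefDr x).

HB.instance Definition _ x := GRing.Additive.copy (tens_coef x)
  (tens_lift (tens_coefDl x) (tens_coefDr x)).

Lemma tens_coefE x a v : tens_coef x (tens a v) = a *~ v@_x.
Proof. exact: tens_liftE. Qed.

(** The formula is claimed for every large enough finite set, so that the sets found for two tensors
    can be merged into their union. *)
Lemma tens_malgE (t : tensor A {malg X}) : exists d : {fset X},
  forall d' : {fset X}, (d `<=` d')%fset ->
    t = \sum_(x <- d') tens (tens_coef x t) << x >>.
Proof.
move: t; apply: tensor_ind.
- by exists fset0 => d' _; rewrite big1 // => x _; rewrite raddf0 tens0l.
- move=> a v; exists (msupp v) => d' vd'; rewrite {1}(monalgEw vd').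
  have tr : {morph @tens A {malg X} a : w w' / w + w'} by move=> w w'; exact: tensDr.
  rewrite -[tens a _]/(addmor tr _) raddf_sum; apply: eq_bigr => x _.
  have tl : {morph (fun a : A => tens a (<< x >> : {malg X})) : v w / v + w}.
    by move=> b c; exact: tensDl.
  rewrite tens_coefE -[RHS]/(addmor tl _) raddfMz -[in LHS](intz v@_x).
  by rewrite raddfMz /= raddfMz.
- move=> t u [d dP] [e eP]; exists (d `|` e)%fset => f; rewrite fsubUset.
  move=> /andP[df ef]; rewrite {1}(dP f df) {1}(eP f ef) -sumrB.
  by apply: eq_bigr => x _; rewrite raddfB tensBl.
Qed.

Lemma tens_coef_eq0 t : (forall x, tens_coef x t = 0) -> t = 0.
Proof.
move=> t0; have [d dP] := tens_malgE t; rewrite (dP d) ?fsubset_refl//.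
by rewrite big1 // => x _; rewrite t0 tens0l.
Qed.

End Flat.

Section Swap.
Variables A B : zmodType.

Definition tswap : tensor A B -> tensor B A :=
  tens_lift (f := fun a b => tens b a) (fun _ _ _ => tensDr _ _ _) (fun _ _ _ => tensDl _ _ _).

HB.instance Definition _ := GRing.Additive.copy tswap
  (tens_lift (f := fun a b => tens b a)
    (fun _ _ _ => tensDr _ _ _) (fun _ _ _ => tensDl _ _ _)).

Lemma tswapE a b : tswap (tens a b) = tens b a.
Proof. exact: tens_liftE. Qed.

End Swap.

Lemma tswapK (A B : zmodType) : cancel (@tswap A B) (@tswap B A).
Proof.
apply: (@tensor_ext _ _ _ (@tswap B A \o @tswap A B) idfun) => a b /=.
by rewrite !tswapE.
Qed.

Lemma tens_map_comp (A B A' B' A'' B'' : zmodType)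
    (f : {additive A -> A'}) (g : {additive B -> B'})
    (f' : {additive A' -> A''}) (g' : {additive B' -> B''}) t :
  tens_map f' g' (tens_map f g t) = tens_map (f' \o f) (g' \o g) t.
Proof.
apply: (@tensor_ext _ _ _ (tens_map f' g' \o tens_map f g)
  (tens_map (f' \o f) (g' \o g))) => a b /=.
by rewrite !tens_mapE.
Qed.

Lemma tens_map_id (A B : zmodType) (f : {additive A -> A}) (g : {additive B -> B}) t :
  f =1 id -> g =1 id -> tens_map f g t = t.
Proof.
move=> fE gE; apply: (@tensor_ext _ _ _ (tens_map f g) idfun) => a b /=.
by rewrite tens_mapE fE gE.
Qed.

Lemma eq_tens_map (A B A' B' : zmodType) (f f' : {additive A -> A'})
    (g g' : {additive B -> B'}) t : f =1 f' -> g =1 g' ->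
  tens_map f g t = tens_map f' g' t.
Proof.
move=> fE gE; apply: (@tensor_ext _ _ _ (tens_map f g) (tens_map f' g')) => a b /=.
by rewrite !tens_mapE fE gE.
Qed.

(** A projective [B] is a retract of [{malg B}], where the coordinates [tens_coef] turn [i (x) 1]
    into copies of [i]. *)
Lemma tens_map_injl (A A' B : zmodType) (i : {additive A -> A'}) t :
  projective B -> injective i ->
  tens_map i (idfun : {additive B -> B}) t = 0 -> t = 0.
Proof.
move=> [s sK] i_inj it.
pose t' := tens_map (idfun : {additive A -> A}) s t.
have it' : tens_map i (idfun : {additive {malg B} -> {malg B}}) t' = 0.
  rewrite -(raddf0 (tens_map (idfun : {additive A' -> A'}) s)) -it.
  by rewrite /t' tens_map_comp [RHS]tens_map_comp; apply: eq_tens_map.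
have t'0 : t' = 0.
  apply: tens_coef_eq0 => x; apply: i_inj; rewrite raddf0 -(raddf0 (tens_coef x)) -it'.
  move: (t'); apply: (@tensor_ext _ _ _ (i \o tens_coef x)
    (tens_coef x \o tens_map i (idfun : {additive {malg B} -> {malg B}}))) => a v /=.
  by rewrite tens_mapE !tens_coefE raddfMz.
have <- : tens_map (idfun : {additive A -> A}) (@free_cover B) t' = t.
  by rewrite /t' tens_map_comp; exact: tens_map_id.
by rewrite t'0 raddf0.
Qed.

Lemma tens_map_inj (A A' B B' : zmodType) (i : {additive A -> A'})
    (j : {additive B -> B'}) t :
  projective A' -> projective B -> injective i -> injective j ->
  tens_map i j t = 0 -> t = 0.
Proof.
move=> pA' pB i_inj j_inj ijt; apply: (tens_map_injl pB i_inj).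
rewrite -[LHS]tswapK -(raddf0 (@tswap B A')); congr (tswap _).
apply: (tens_map_injl pA' j_inj).
rewrite -(raddf0 (@tswap A' B')) -ijt.
apply: (@tensor_ext _ _ _ (tens_map j (idfun : {additive A' -> A'}) \o
  @tswap A' B \o tens_map i (idfun : {additive B -> B}))
  (@tswap A' B' \o tens_map i j)) => a b /=.
by rewrite !(tens_mapE, tswapE).
Qed.

(** On a free group with ordered basis, [g] keeps the values [b x y] with
    [x < y]; a projective group is a retract of a free one. *)
Lemma alternating_split (P Y : zmodType) (b : P -> P -> Y) :
  projective P ->
  (forall x y z, b (x + y) z = b x z + b y z) ->
  (forall x y z, b x (y + z) = b x y + b x z) ->
  (forall x, b x x = 0) ->
  exists g : {additive tensor P P -> Y},
    forall x y, g (tens x y) - g (tens y x) = b x y.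
Proof.
move=> [s sK] bDl bDr bxx.
have bN x y : b y x = - b x y.
  apply: (addrI (b x y)); rewrite subrr.
  by have := bxx (x + y); rewrite bDl !bDr !bxx add0r addr0.
have [R woR] := wochoice.well_ordering_principle P.
pose g0 x y := if R x y then b x y else 0.
have g0B x y : g0 x y - g0 y x = b x y.
  rewrite /g0; case: (boolP (R x y)) => Rxy; case: (boolP (R y x)) => Ryx.
  - by rewrite (@well_order_anti _ _ woR x y) ?Rxy// bxx subrr.
  - by rewrite subr0.
  - by rewrite sub0r bN opprK.
  - by move: (well_order_total woR x y); rewrite (negPf Rxy) (negPf Ryx).
pose g1 (u v : {malg P}) := zlift (fun x => zlift (g0 x) v) u.
have g1Dl u u' v : g1 (u + u') v = g1 u v + g1 u' v by exact: raddfD.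
have g1Dr u v v' : g1 u (v + v') = g1 u v + g1 u v'.
  rewrite /g1 -zlift_addf; congr (zlift _ u); apply: funext => x.
  exact: raddfD.
pose g2 x y := g1 (s x) (s y).
have g2Dl x y z : g2 (x + y) z = g2 x z + g2 y z by rewrite /g2 raddfD g1Dl.
have g2Dr x y z : g2 x (y + z) = g2 x y + g2 x z by rewrite /g2 raddfD g1Dr.
exists (tens_lift g2Dl g2Dr) => x y /=; rewrite !tens_liftE /g2.
rewrite -[in RHS](sK x) -[in RHS](sK y); move: (s x) (s y) => u v.
have g1u v0 : {morph (fun u => g1 u v0 - g1 v0 u - b (@free_cover P u) (@free_cover P v0))
    : u u' / u + u'}.
  move=> u1 u2; rewrite g1Dl g1Dr (raddfD (@free_cover P)) bDl !opprD.
  by rewrite [X in X + _]addrACA; exact: addrACA.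
apply/eqP; rewrite -subr_eq0; apply/eqP; move: u.
apply: (@malg_ext _ _ (addmor (g1u v)) (\0 : {additive _ -> _})) => {}x.
rewrite /= /addmor; have g1v : {morph (fun v => g1 << x >> v - g1 v << x >> -
    b (@free_cover P << x >>) (@free_cover P v)) : v v' / v + v'}.
  move=> u1 u2; rewrite g1Dl g1Dr (raddfD (@free_cover P)) bDr !opprD.
  by rewrite [X in X + _]addrACA; exact: addrACA.
move: v; apply: (@malg_ext _ _ (addmor g1v) (\0 : {additive _ -> _})) => {}y.
by rewrite /= /addmor /g1 /free_cover !zliftU g0B subrr.
Qed.

(** The image of [q], as [P / ker q], is a subgroup of a projective group, hence projective, and the
    surjection onto it splits. The splitting provides a complement of the kernel. *)
Lemma ker_factor (P A : zmodType) (q : {additive P -> A}) : projective A ->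
  exists N : zmodType, exists pi : {additive P -> N},
  exists j : {additive N -> A}, exists s : {additive N -> P},
  [/\ projective N, injective j, forall x, j (pi x) = q x & cancel s pi].
Proof.
move=> pA; pose K := [set x : P | q x = 0].
have qK x : K x -> q x = 0 by [].
pose j : {additive zquot K -> A} := zquot_lift qK.
have jE x : j (zpi K x) = q x by exact: (zquot_liftE qK).
have j_inj : injective j.
  move=> u v; have [x ->] := zquotP u; have [y ->] := zquotP v.
  rewrite !jE => qxy; apply/zpiP; apply: sub_gen_smallest.
  by rewrite /K /= raddfB qxy subrr.
have pN : projective (zquot K) := projective_sub pA j_inj.
have [|s sE] := @projective_lift _ _ _ (zpi K) (idfun : {additive zquot K -> zquot K}) pN.
  by move=> u; have [x ->] := zquotP u; exists x.
by exists (zquot K), (zpi K), j, s.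
Qed.

(** * Chain homotopies between Koszul complexes *)

Section KoszulImage.
Variables (C B : zmodType) (i : {additive C -> B}).

Definition koszul2_im : set (tensor C B) := [set t | exists w, t = koszul2 i w].

Lemma koszul2_im_sub : is_addsubgroup koszul2_im.
Proof.
split=> [|_ _ [w ->] [w' ->]]; first by exists 0; rewrite raddf0.
by exists (w - w'); rewrite raddfB.
Qed.

Lemma zpi_koszul2_sym c c' :
  zpi koszul2_im (tens c (i c')) = zpi koszul2_im (tens c' (i c)).
Proof.
apply/eqP; rewrite -subr_eq0 -raddfB; apply/eqP/zpi_eq0.
by exists (wedge c c'); rewrite koszul2E.
Qed.

End KoszulImage.

Section KoszulHomotopy.
Variables (C B C' B' : zmodType) (i : {additive C -> B}) (i' : {additive C' -> B'}).
Variables (h h' : {additive C -> C'}) (g g' : {additive B -> B'}).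
Variable s : {additive B -> C'}.
Hypothesis hg : forall c, i' (h c) = g (i c).
Hypothesis gs : forall b, g' b = g b + i' (s b).
Hypothesis hs : forall c, h' c = h c + s (i c).

Local Notation piK := (zpi (koszul2_im i')).

(** A lift through [koszul1] of [g' b1 * g' b2 - g b1 * g b2] in the symmetric square. The last term
    is the quadratic correction; it is symmetric only modulo the image of [koszul2], hence the
    values in the quotient. *)
Let hform (b1 b2 : B) : zquot (koszul2_im i') :=
  piK (tens (s b1) (g b2) + tens (s b2) (g b1) + tens (s b1) (i' (s b2))).

Fact hformC b1 b2 : hform b1 b2 = hform b2 b1.
Proof.
rewrite /hform !raddfD /= zpi_koszul2_sym; congr (_ + _).
exact: addrC.
Qed.

Fact hformDl b1 b2 b : hform (b1 + b2) b = hform b1 b + hform b2 b.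
Proof.
rewrite /hform !(raddfD s) !(raddfD g) !tensDl tensDr -[RHS](raddfD piK).
congr (zpi _ _); rewrite [X in X + _]addrACA; exact: addrACA.
Qed.

Fact hformDr b b1 b2 : hform b (b1 + b2) = hform b b1 + hform b b2.
Proof. by rewrite hformC hformDl !(hformC b). Qed.

Fact hform_sym u : sym_rel u -> tens_lift hformDl hformDr u = 0.
Proof. by move=> [a [b ->]]; rewrite raddfB /= !tens_liftE hformC subrr. Qed.

(** Modulo boundaries, the difference of the two maps is [hform] composed with [koszul1], so it
    vanishes on cycles. *)
Lemma koszul_homotopy t : koszul1 i t = 0 ->
  koszul2_im i' (tens_map h' g' t - tens_map h g t).
Proof.
move=> t0; apply: zpi_eq0P; first exact: koszul2_im_sub.
rewrite -(raddf0 (zquot_lift hform_sym)) -t0.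
apply: (@tensor_ext _ _ _ (piK \o (tens_map h' g' \- tens_map h g))
  (zquot_lift hform_sym \o koszul1 i)) => c b /=.
rewrite koszul1E [RHS](zquot_liftE hform_sym) /= tens_liftE /hform !tens_mapE.
rewrite gs hs tensDl !tensDr addrAC [X in X + _]addrAC subrr add0r.
by rewrite !raddfD /= -hg zpi_koszul2_sym addrCA addrA.
Qed.

End KoszulHomotopy.

Section LiftHomotopy.
Variables (C B B' D : zmodType) (i : {additive C -> B}) (p : {additive B' -> D}).
Local Notation i' := (val : {additive kernel p -> B'}).
Variables (h h' : {additive C -> kernel p}) (g g' : {additive B -> B'}).
Hypothesis hg : forall c, val (h c) = g (i c).
Hypothesis hg' : forall c, val (h' c) = g' (i c).
Hypothesis pgg' : forall b, p (g b) = p (g' b).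

(** The homotopy is [g' - g] itself, which takes its values in [kernel p]. *)
Lemma koszul_lift_homotopy t : koszul1 i t = 0 ->
  koszul2_im i' (tens_map h' g' t - tens_map h g t).
Proof.
have s0 b : p (g' b - g b) = 0 by rewrite raddfB pgg' subrr.
have sD : {morph (fun b => Kernel (s0 b)) : b b' / b + b'}.
  by move=> b b'; apply: val_inj; rewrite /= !raddfD addrACA.
apply: (@koszul_homotopy _ _ _ _ _ _ _ _ _ _ (addmor sD)) => [c|b|c].
- exact: hg.
- by rewrite /addmor /= addrCA subrr addr0.
- by apply: val_inj; rewrite raddfD /= /addmor /= hg hg' addrCA subrr addr0.
Qed.

End LiftHomotopy.

(** * The Koszul complex of a sum of two kernels *)

Section TwoKernels.
Variables (P D A1 A2 : zmodType) (p : {additive P -> D}).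
Variables (q1 : {additive P -> A1}) (q2 : {additive P -> A2}).
Hypothesis q12_inj : forall x, q1 x = 0 -> q2 x = 0 -> x = 0.
Hypothesis ker_p : forall x, p x = 0 <->
  exists u v, [/\ q1 u = 0, q2 v = 0 & x = u + v].

Local Notation C := (kernel p).
Local Notation i := (val : {additive C -> P}).

Definition alt_rel : set (tensor P P) :=
  [set z | exists a b, (q1 a = 0 /\ q1 b = 0 \/ q2 a = 0 /\ q2 b = 0) /\
    z = tens a b - tens b a].

Local Notation piQ := (zpi alt_rel).

Fact ker_pr_ex (c : C) : exists u, q1 u = 0 /\ q2 (val c - u) = 0.
Proof.
have [u [v [qu qv cE]]] := (ker_p (val c)).1 (kernelP c).
by exists u; rewrite cE addrAC subrr add0r.
Qed.

Definition ker_pr c := sval (cid (ker_pr_ex c)).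

Lemma ker_pr1 c : q1 (ker_pr c) = 0.
Proof. by rewrite /ker_pr; case: cid => u []. Qed.

Lemma ker_pr2 c : q2 (val c - ker_pr c) = 0.
Proof. by rewrite /ker_pr; case: cid => u []. Qed.

Lemma ker_pr_uniq c u : q1 u = 0 -> q2 (val c - u) = 0 -> ker_pr c = u.
Proof.
move=> qu qcu; apply/eqP; rewrite -subr_eq0; apply/eqP/q12_inj.
  by rewrite raddfB ker_pr1 qu subrr.
have -> : ker_pr c - u = (val c - u) - (val c - ker_pr c).
  by rewrite opprB [RHS]addrC addrA subrK.
by rewrite raddfB ker_pr2 qcu subrr.
Qed.

Fact ker_prD : {morph ker_pr : c c' / c + c'}.
Proof.
move=> c c'; apply: ker_pr_uniq; first by rewrite raddfD !ker_pr1 addr0.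
rewrite (raddfD (val : {additive C -> P})) /= opprD addrACA (raddfD q2).
by rewrite !ker_pr2 addr0.
Qed.

Fact eta_Dl c c' x :
  tens (ker_pr (c + c')) x + tens x (val (c + c') - ker_pr (c + c')) =
  (tens (ker_pr c) x + tens x (val c - ker_pr c)) +
  (tens (ker_pr c') x + tens x (val c' - ker_pr c')).
Proof.
rewrite ker_prD (raddfD (val : {additive C -> P})) /= opprD [_ + _ + (_ - _)]addrACA.
by rewrite tensDr tensDl addrACA.
Qed.

Fact eta_Dr c x x' :
  tens (ker_pr c) (x + x') + tens (x + x') (val c - ker_pr c) =
  (tens (ker_pr c) x + tens x (val c - ker_pr c)) +
  (tens (ker_pr c) x' + tens x' (val c - ker_pr c)).
Proof. by rewrite tensDl tensDr addrACA. Qed.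

(** The second component goes to the right so that [tens_map q1 q2] vanishes on the image: [q1]
    kills the left factor of the first term, [q2] the right factor of the second. Symmetrization
    forgets the sides, so there [eta] becomes [koszul1]. *)
Definition eta : tensor C P -> tensor P P := tens_lift eta_Dl eta_Dr.

HB.instance Definition _ := GRing.Additive.copy eta (tens_lift eta_Dl eta_Dr).

Lemma etaE c x : eta (tens c x) = tens (ker_pr c) x + tens x (val c - ker_pr c).
Proof. exact: tens_liftE. Qed.

Lemma zpi_alt1 a b : q1 a = 0 -> q1 b = 0 -> piQ (tens a b) = piQ (tens b a).
Proof.
move=> qa qb; apply/eqP; rewrite -subr_eq0 -raddfB; apply/eqP/zpi_eq0.
by exists a, b; split=> //; left.
Qed.

Lemma zpi_alt2 a b : q2 a = 0 -> q2 b = 0 -> piQ (tens a b) = piQ (tens b a).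
Proof.
move=> qa qb; apply/eqP; rewrite -subr_eq0 -raddfB; apply/eqP/zpi_eq0.
by exists a, b; split=> //; right.
Qed.

(** With [c = u + v] and [c' = u' + v'], the mixed terms of [u (x) c' + c' (x) v - u' (x) c - c (x)
    v'] cancel, leaving [u (x) u' - u' (x) u] and [v' (x) v - v (x) v']. *)
Lemma eta_koszul2 w : piQ (eta (koszul2 i w)) = 0.
Proof.
apply: (@Ext2_ext _ _ (piQ \o eta \o koszul2 i) (\0 : {additive _ -> _})) => c c'.
rewrite /= koszul2E !raddfB /= !etaE; apply/eqP; rewrite subr_eq0; apply/eqP.
have [] : val c = ker_pr c + (val c - ker_pr c) /\
    val c' = ker_pr c' + (val c' - ker_pr c').
  by rewrite ![ker_pr _ + _]addrC !subrK.
move: (ker_pr1 c) (ker_pr1 c') (ker_pr2 c) (ker_pr2 c').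
move: (ker_pr c) (ker_pr c') (val c - _) (val c' - _).
move=> u u' v v' qu qu' qv qv' -> ->.
rewrite !tensDl !tensDr !raddfD /= (zpi_alt1 qu qu') (zpi_alt2 qv qv').
exact: addrACA.
Qed.

Lemma eta_sym t : zpi (@sym_rel P) (eta t) = koszul1 i t.
Proof.
apply: (@tensor_ext _ _ _ (zpi (@sym_rel P) \o eta) (koszul1 i)) => c x /=.
rewrite koszul1E etaE raddfD /= -!/(sprod _ _) [X in _ + X]sprodC /sprod -raddfD.
by rewrite -tensDl addrC subrK.
Qed.

Lemma eta_ker t : tens_map q1 q2 (eta t) = 0.
Proof.
apply: (@tensor_ext _ _ _ (tens_map q1 q2 \o eta) (\0 : {additive _ -> _})) => c x /=.
by rewrite etaE raddfD /= !tens_mapE ker_pr1 ker_pr2 tens0l tens0r addr0.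
Qed.

End TwoKernels.

Section TwoKernelsProjective.
Variables (P D A1 A2 : zmodType) (p : {additive P -> D}).
Variables (q1 : {additive P -> A1}) (q2 : {additive P -> A2}).
Hypothesis p_surj : forall d, exists x, p x = d.
Hypothesis q12_inj : forall x, q1 x = 0 -> q2 x = 0 -> x = 0.
Hypothesis ker_p : forall x, p x = 0 <->
  exists u v, [/\ q1 u = 0, q2 v = 0 & x = u + v].

Local Notation C := (kernel p).
Local Notation i := (val : {additive C -> P}).
Local Notation piQ := (zpi (alt_rel q1 q2)).
Local Notation pr := (ker_pr ker_p).
Local Notation eta := (eta q12_inj ker_p).

Section Splitting.
Hypothesis projA1 : projective A1.
Hypothesis projA2 : projective A2.

(** [r1] and [r2] project onto the two kernels along complements. The last clause holds because
    [(1 - r1) (x) (1 - r2)] factors through the tensor product of the images of [q1] and [q2], which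
    embeds in [A1 (x) A2] by flatness. *)
Lemma ker_retracts : exists r1 r2 : {additive P -> C},
  [/\ forall x, q1 (val (r1 x)) = 0 /\ q2 (val (r2 x)) = 0,
      forall x, q1 x = 0 -> val (r1 x) = x,
      forall x, q2 x = 0 -> val (r2 x) = x &
      forall z, tens_map q1 q2 z = 0 ->
        tens_map (idfun \- (i \o r1)) (idfun \- (i \o r2)) z = 0].
Proof.
have [N1 [pi1 [j1 [s1 [pN1 j1_inj j1E s1K]]]]] := ker_factor q1 projA1.
have [N2 [pi2 [j2 [s2 [pN2 j2_inj j2E s2K]]]]] := ker_factor q2 projA2.
have r1q a : q1 (a - s1 (pi1 a)) = 0.
  by rewrite -j1E raddfB s1K subrr raddf0.
have r2q a : q2 (a - s2 (pi2 a)) = 0.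
  by rewrite -j2E raddfB s2K subrr raddf0.
have r1p a : p (a - s1 (pi1 a)) = 0.
  by apply/ker_p; exists (a - s1 (pi1 a)), 0; rewrite raddf0 addr0.
have r2p a : p (a - s2 (pi2 a)) = 0.
  by apply/ker_p; exists 0, (a - s2 (pi2 a)); rewrite raddf0 add0r.
have r1D : {morph (fun a => Kernel (r1p a)) : a b / a + b}.
  by move=> a b; apply: val_inj; rewrite /= (raddfD pi1) (raddfD s1) opprD addrACA.
have r2D : {morph (fun a => Kernel (r2p a)) : a b / a + b}.
  by move=> a b; apply: val_inj; rewrite /= (raddfD pi2) (raddfD s2) opprD addrACA.
exists (addmor r1D), (addmor r2D); split=> [x|x qx|x qx|z qz].
- by split; [exact: r1q|exact: r2q].
- have pix : pi1 x = 0 by apply: j1_inj; rewrite j1E qx raddf0.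
  by rewrite /= pix raddf0 subr0.
- have pix : pi2 x = 0 by apply: j2_inj; rewrite j2E qx raddf0.
  by rewrite /= pix raddf0 subr0.
- have piz : tens_map pi1 pi2 z = 0.
    apply: (@tens_map_inj _ _ _ _ j1 j2) => //.
    by rewrite tens_map_comp -qz; apply: eq_tens_map.
  have <- : tens_map s1 s2 (tens_map pi1 pi2 z) = 0 by rewrite piz raddf0.
  rewrite tens_map_comp; by apply: eq_tens_map => x; rewrite /= opprB addrC subrK.
Qed.

(** [theta] is chosen so that [eta] after [theta] is [1 - (1 - r1) (x) (1 - r2)], the identity on
    the kernel of [q1 (x) q2]. In the other order the two maps compose to the identity modulo
    boundaries. *)
Lemma eta_split : exists theta : {additive tensor P P -> tensor C P},
  [/\ forall t, koszul2_im i (theta (eta t) - t),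
      forall z, alt_rel q1 q2 z -> koszul2_im i (theta z) &
      forall z, tens_map q1 q2 z = 0 -> eta (theta z) = z].
Proof.
have [r1 [r2 [rq r1v r2v rz]]] := ker_retracts.
pose th a b := tens (r1 a) b + tens (r2 b) (a - val (r1 a)).
have thDl a a' b : th (a + a') b = th a b + th a' b.
  rewrite /th (raddfD r1) (raddfD i) opprD (addrACA a a').
  by rewrite (tensDl (r1 a)) (tensDr (r2 b)); exact: (@addrACA (tensor C P)).
have thDr a b b' : th a (b + b') = th a b + th a b'.
  by rewrite /th (raddfD r2) tensDl tensDr; exact: (@addrACA (tensor C P)).
have [theta thE] : exists theta : {additive tensor P P -> tensor C P},
    forall a b, theta (tens a b) = th a b.
  by exists (tens_lift thDl thDr) => a b; exact: tens_liftE.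
(* [K c x] is the class of [tens c x] modulo boundaries; besides bilinearity, the only relation used
   is its symmetry on [C]. *)
have [Y [piK piK0 [K [KE KDl KDr KS]]]] : exists Y : zmodType,
    exists2 piK : {additive tensor C P -> Y}, forall t, piK t = 0 -> koszul2_im i t &
    exists K : C -> P -> Y, [/\ forall c x, piK (tens c x) = K c x,
      forall c c' x, K (c + c') x = K c x + K c' x,
      forall c x x', K c (x + x') = K c x + K c x' &
      forall c c', K c (val c') = K c' (val c)].
  exists (zquot (koszul2_im i)), (zpi (koszul2_im i)) => [t|].
    by apply: zpi_eq0P; exact: koszul2_im_sub.
  exists (fun c x => zpi (koszul2_im i) (tens c x)); split=> [//|c c' x|c x x'|c c'].
  - by rewrite tensDl raddfD.
  - by rewrite tensDr raddfD.
  - exact: (zpi_koszul2_sym i).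
have th1 a b : q1 a = 0 -> piK (theta (tens a b)) = K (r1 a) b.
  by move=> qa; rewrite thE /th r1v // subrr tens0r addr0 KE.
have th2 a b : q2 b = 0 -> piK (theta (tens a b)) = K (r2 b) a.
  move=> qb; rewrite thE; apply: etrans (raddfD piK _ _) _.
  apply: etrans (congr2 +%R (KE _ _) (KE _ _)) _.
  rewrite -[X in K (r1 a) X](r2v b qb) KS -KDr.
  by congr (K _ _); rewrite addrC subrK.
exists theta; split.
- move=> t; apply: piK0; rewrite raddfB; apply/eqP; rewrite subr_eq0; apply/eqP.
  apply: (@tensor_ext _ _ _ (piK \o theta \o eta) piK) => c x.
  have q1c := ker_pr1 ker_p c; have q2c := ker_pr2 ker_p c.
  rewrite -[LHS]/(piK (theta (eta (tens c x)))) etaE (raddfD theta) (raddfD piK).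
  rewrite (th1 _ x q1c) (th2 x _ q2c) KE -KDl; congr (K _ _).
  apply: val_inj; apply: etrans (raddfD i _ _) _.
  by rewrite [i _](r1v _ q1c) [i _](r2v _ q2c) addrC subrK.
- move=> z [a [b [[[qa qb]|[qa qb]] ->]]]; apply: piK0.
    rewrite (raddfB theta) (raddfB piK) (th1 a b qa) (th1 b a qb).
    by rewrite -[X in K (r1 a) X](r1v b qb) -[X in K (r1 b) X](r1v a qa) KS subrr.
  rewrite (raddfB theta) (raddfB piK) (th2 a b qb) (th2 b a qa).
  by rewrite -[X in K (r2 b) X](r2v a qa) -[X in K (r2 a) X](r2v b qb) KS subrr.
- move=> z qz; rewrite -[RHS]subr0 -(rz _ qz).
  apply: (@tensor_ext _ _ _ (eta \o theta)
    (idfun \- tens_map (idfun \- (i \o r1)) (idfun \- (i \o r2)))) => a b.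
  rewrite -[LHS]/(eta (theta (tens a b))).
  rewrite -[RHS]/(tens a b - tens_map (idfun \- (i \o r1)) (idfun \- (i \o r2)) (tens a b)).
  rewrite tens_mapE thE; apply: etrans (raddfD eta _ _) _.
  apply: etrans (congr2 +%R (etaE _ _ _ _) (etaE _ _ _ _)) _.
  have -> : pr (r1 a) = val (r1 a).
    by apply: (ker_pr_uniq q12_inj); rewrite ?subrr ?raddf0 //; case: (rq a).
  have -> : pr (r2 b) = 0.
    by apply: (ker_pr_uniq q12_inj); rewrite ?subr0 ?raddf0 //; case: (rq b).
  rewrite subrr tens0r tens0l addr0 add0r subr0 /= (tensBr (a - _)) opprB addrCA.
  rewrite -tensBl [RHS]addrC; congr (tens _ _ + _).
  by rewrite opprB addrC subrK.
Qed.

Lemma eta_inj t : piQ (eta t) = 0 -> koszul2_im i t.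
Proof.
have [theta [thK thalt _]] := eta_split; have [im0 imB] := koszul2_im_sub i.
rewrite -(raddf0 piQ) => /zpiP; rewrite subr0 => h.
have -> : t = theta (eta t) - (theta (eta t) - t) by rewrite opprB addrC subrK.
apply: (imB) => //; move: h; move: (eta t) => z.
suff h : smallest (@is_addsubgroup _) (alt_rel q1 q2) `<=`
    [set z | koszul2_im i (theta z)] by move/h.
apply: smallest_sub => //; split=> [|x y]; rewrite /= ?raddf0//.
by rewrite raddfB; exact: imB.
Qed.

Lemma eta_surj z : zpi (@sym_rel P) z = 0 -> tens_map q1 q2 z = 0 ->
  exists2 t, koszul1 i t = 0 & eta t = z.
Proof.
have [theta [_ _ thK]] := eta_split.
by move=> z0 qz; exists (theta z); rewrite ?thK // -(eta_sym q12_inj ker_p) thK.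
Qed.

End Splitting.

Fact lift_cover_ex : exists delta : {additive {malg D} -> P},
  forall u, p (delta u) = free_cover u.
Proof. by apply: projective_lift; [exact: projective_malg|]. Qed.

Definition lift_cover := sval (cid lift_cover_ex).

Lemma lift_coverE u : p (lift_cover u) = free_cover u.
Proof. by rewrite /lift_cover; case: cid. Qed.

Fact lift_cover_ker u : free_cover u = 0 -> p (lift_cover u) = 0.
Proof. by rewrite lift_coverE. Qed.

Definition lift_syzygy : {additive syzygy D -> C} := kernel_map lift_cover_ker.

Definition lift_cycle : {additive tensor (syzygy D) {malg D} -> tensor C P} :=
  tens_map lift_syzygy lift_cover.

Local Notation val1 := (val : {additive kernel (koszul1 (@syzygy_val D)) -> _}).

Fact Psi_rel (z : kernel (koszul1 (@syzygy_val D))) :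
  (exists w, val z = koszul2 (@syzygy_val D) w) ->
  (piQ \o eta \o lift_cycle \o val1) z = 0.
Proof.
move=> [w /= ->]; rewrite /lift_cycle.
by rewrite (@koszul2_nat _ _ _ _ (@syzygy_val D) i) // eta_koszul2.
Qed.

(** The comparison of the canonical resolution of [D] with [kernel p -> P], followed by [eta].
    Another choice of [lift_cover] changes cycles by boundaries, which [eta] sends to zero in the
    quotient. *)
Definition Psi : {additive L1SP2 D -> zquot (alt_rel q1 q2)} :=
  zquot_lift (X := [set z | exists w, val z = koszul2 (@syzygy_val D) w]) Psi_rel.

Lemma PsiE z : Psi (zpi _ z) = piQ (eta (lift_cycle (val z))).
Proof. exact: (zquot_liftE Psi_rel). Qed.

Lemma Psi_im l : exists z, [/\ zpi (@sym_rel P) z = 0, tens_map q1 q2 z = 0 &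
  Psi l = piQ z].
Proof.
have [z ->] := zquotP l; exists (eta (lift_cycle (val z))); split.
- rewrite eta_sym.
  exact: (@koszul_ker _ _ _ _ (@syzygy_val D) i lift_syzygy lift_cover
    (fun c => erefl) _ (kernelP z)).
- exact: eta_ker.
- exact: PsiE.
Qed.

Section Comparison.
Hypotheses (projA1 : projective A1) (projA2 : projective A2).
Hypothesis projP : projective P.

Fact colift_cover_ex : exists gamma : {additive P -> {malg D}},
  forall x, free_cover (gamma x) = p x.
Proof. by apply: projective_lift => // x; exists << p x >>; exact: zliftU. Qed.

(** Projectivity of [P] gives a map back to the canonical resolution; on cycles the round trip is
    the identity up to boundaries. *)
Lemma Psi_inj l : Psi l = 0 -> l = 0.
Proof.
have [gamma gammaE] := colift_cover_ex.
have gk x : p x = 0 -> free_cover (gamma x) = 0 by rewrite gammaE.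
have [z ->] := zquotP l; rewrite PsiE => /(eta_inj projA1 projA2)[w zw].
pose k : {additive C -> syzygy D} := kernel_map gk.
apply: zpi_eq0.
have : koszul2_im (@syzygy_val D) (tens_map k gamma (lift_cycle (val z)) - val z).
  rewrite -[X in _ - X](@tens_map_id _ _ idfun idfun) // /lift_cycle tens_map_comp.
  apply: (@koszul_lift_homotopy (syzygy D) {malg D} {malg D} D
    (@syzygy_val D) (@free_cover D)) => //; last exact: kernelP.
  by move=> b /=; rewrite gammaE lift_coverE.
rewrite zw (@koszul2_nat _ _ _ _ i (@syzygy_val D)) // => -[w' w'E].
exists (Ext2_map k w - w'); rewrite raddfB /= -w'E.
by rewrite opprB addrC subrK.
Qed.

Lemma Psi_surj z : zpi (@sym_rel P) z = 0 -> tens_map q1 q2 z = 0 ->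
  exists l, Psi l = piQ z.
Proof.
have [gamma gammaE] := colift_cover_ex.
have gk x : p x = 0 -> free_cover (gamma x) = 0 by rewrite gammaE.
pose k : {additive C -> syzygy D} := kernel_map gk.
move=> z0 qz; have [t t0 <-] := eta_surj projA1 projA2 z0 qz.
have kt : koszul1 (@syzygy_val D) (tens_map k gamma t) = 0.
  by apply: (@koszul_ker _ _ _ _ i).
exists (zpi _ (Kernel kt)); rewrite PsiE /=.
apply/eqP; rewrite -subr_eq0 -!raddfB.
have [w ->] : koszul2_im i (lift_cycle (tens_map k gamma t) - t).
  rewrite -[X in _ - X](@tens_map_id _ _ idfun idfun) //.
  rewrite [lift_cycle _]tens_map_comp.
  apply: (@koszul_lift_homotopy _ _ _ D i p) => //.
  by move=> b /=; rewrite lift_coverE gammaE.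
by apply/eqP; exact: eta_koszul2.
Qed.

End Comparison.
End TwoKernelsProjective.

(** * Naturality of the comparison map *)

Section PsiNaturality.
Variables (P D A1 A2 : zmodType) (p : {additive P -> D}).
Variables (q1 : {additive P -> A1}) (q2 : {additive P -> A2}).
Hypothesis p_surj : forall d, exists x, p x = d.
Hypothesis q12_inj : forall x, q1 x = 0 -> q2 x = 0 -> x = 0.
Hypothesis ker_p : forall x, p x = 0 <->
  exists u v, [/\ q1 u = 0, q2 v = 0 & x = u + v].
Variables (P' D' A1' A2' : zmodType) (p' : {additive P' -> D'}).
Variables (q1' : {additive P' -> A1'}) (q2' : {additive P' -> A2'}).
Hypothesis p_surj' : forall d, exists x, p' x = d.
Hypothesis q12_inj' : forall x, q1' x = 0 -> q2' x = 0 -> x = 0.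
Hypothesis ker_p' : forall x, p' x = 0 <->
  exists u v, [/\ q1' u = 0, q2' v = 0 & x = u + v].
Variables (phi : {additive P -> P'}) (f : {additive D -> D'}).
Hypothesis p_phi : forall x, p' (phi x) = f (p x).
Hypothesis q1_phi : forall x, q1 x = 0 -> q1' (phi x) = 0.
Hypothesis q2_phi : forall x, q2 x = 0 -> q2' (phi x) = 0.

Lemma zpi_alt_map z z' : zpi (alt_rel q1 q2) z = zpi (alt_rel q1 q2) z' ->
  zpi (alt_rel q1' q2') (tens_map phi phi z) =
  zpi (alt_rel q1' q2') (tens_map phi phi z').
Proof.
move=> /zpiP h; apply/zpiP; rewrite -raddfB; move: (z - z') h => {z z'}.
have [s0 sB] := smallest_addsubgroup (alt_rel q1' q2').
suff h : smallest (@is_addsubgroup _) (alt_rel q1 q2) `<=`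
    [set z | smallest (@is_addsubgroup _) (alt_rel q1' q2') (tens_map phi phi z)].
  by move=> z /h.
apply: smallest_sub; first by split=> [|x y]; rewrite /= ?raddf0 ?raddfB//; exact: sB.
move=> _ [a [b [ab ->]]] /=; apply: sub_gen_smallest.
exists (phi a), (phi b); rewrite raddfB /= !tens_mapE; split=> //.
by case: ab => -[qa qb]; [left|right]; split; [exact: q1_phi|exact: q1_phi
  |exact: q2_phi|exact: q2_phi].
Qed.

Fact phi_ker x : p x = 0 -> p' (phi x) = 0.
Proof. by rewrite p_phi => ->; rewrite raddf0. Qed.

Lemma eta_nat t : tens_map phi phi (eta q12_inj ker_p t) =
  eta q12_inj' ker_p' (tens_map (kernel_map phi_ker) phi t).
Proof.
apply: (@tensor_ext _ _ _ (tens_map phi phi \o eta q12_inj ker_p)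
  (eta q12_inj' ker_p' \o tens_map (kernel_map phi_ker) phi)) => c x /=.
rewrite etaE raddfD /= !tens_mapE etaE /=.
have -> : ker_pr ker_p' (kernel_map phi_ker c) = phi (ker_pr ker_p c).
  apply: (ker_pr_uniq q12_inj'); first exact/q1_phi/ker_pr1.
  by rewrite /= -raddfB; exact/q2_phi/ker_pr2.
by rewrite raddfB.
Qed.

(** [phi] after [lift_cover], and [lift_cover] after [zmap f], lift the same map to [D'], so they
    are homotopic. The representative [z] stands in for the induced map between the two
    quotients. *)
Lemma Psi_nat l z : Psi p_surj q12_inj ker_p l = zpi (alt_rel q1 q2) z ->
  Psi p_surj' q12_inj' ker_p' (L1SP2_map f l) =
  zpi (alt_rel q1' q2') (tens_map phi phi z).
Proof.
have [t ->] := zquotP l; rewrite PsiE => /zpi_alt_map <-.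
have -> : L1SP2_map f (zpi _ t) =
    zpi _ (kernel_map (koszul_ker (syzygy_map_val f)) t).
  exact: (zquot_liftE (koszul_im _)).
rewrite PsiE /= eta_nat; apply/eqP; rewrite -subr_eq0 -!raddfB.
rewrite /lift_cycle !tens_map_comp.
have [w ->] : koszul2_im (val : {additive kernel p' -> P'})
    (tens_map (lift_syzygy p_surj' \o syzygy_map f)
       (lift_cover p_surj' \o zmap f) (val t) -
     tens_map (kernel_map phi_ker \o lift_syzygy p_surj)
       (phi \o lift_cover p_surj) (val t)).
  apply: (@koszul_lift_homotopy _ _ _ _ (@syzygy_val D)) => //; last exact: kernelP.
  by move=> b /=; rewrite p_phi !lift_coverE free_cover_nat.
by apply/eqP; exact: eta_koszul2.
Qed.

End PsiNaturality.

(** * Lifting homomorphisms from a normal subgroup of a free group *)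

Section SubgroupOf.
Variables (G : groupType) (H : set G) (sH : is_subgroup H).

Definition sgpred_of of is_subgroup H : {pred G} := [pred x | `[< H x >]].

Fact sgpred_of_closed : group_closed (sgpred_of sH).
Proof.
case: (sH) => H1 HF; split=> [|x y]; rewrite !unfold_in; first exact/asboolP.
by move=> /asboolP Hx /asboolP Hy; apply/asboolP; exact: HF.
Qed.

Definition subgroup_of : Type := {x : G | sgpred_of sH x}.

HB.instance Definition _ := SubChoice.on subgroup_of.
HB.instance Definition _ :=
  SubChoice_isSubGroup.Build G (sgpred_of sH) subgroup_of sgpred_of_closed.

Lemma subgroup_ofP (x : subgroup_of) : H (val x).
Proof. by have /asboolP := valP x. Qed.

End SubgroupOf.

(** The basis is lifted into [W0], seen as a group of its own; by uniqueness in the universal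
    property, composing the extension with [pW] gives the identity. *)
Lemma free_lift (F W : groupType) (W0 : set W) (pW : {multiplicative W -> F}) :
  free_group F -> is_subgroup W0 -> (forall g, exists2 w, W0 w & pW w = g) ->
  exists h : {multiplicative F -> W}, forall g, W0 (h g) /\ pW (h g) = g.
Proof.
move=> [B freeB] sW0 W0_surj.
have /choice[f fP] g : exists w : subgroup_of sW0, pW (val w) = g.
  have [w W0w pw] := W0_surj g.
  have W0w' : sgpred_of sW0 w by apply/asboolP.
  by exists (Sub w W0w').
have [h [hB _]] := freeB _ f; exists (val \o h) => g.
split; first exact: subgroup_ofP.
have [h0 [_ h0_uniq]] := freeB _ (@id F).
have -> : pW ((val \o h) g) = h0 g.
  by apply: (h0_uniq (pW \o val \o h)) => x Bx /=; rewrite hB // fP.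
by symmetry; apply: (h0_uniq idfun).
Qed.

(** The wreath product [F |x E^F] for the right regular action of [F]. *)
Definition wreath (F E : groupType) : Type := (F * (F -> E))%type.

HB.instance Definition _ (F E : groupType) := gen_eqMixin (wreath F E).
HB.instance Definition _ (F E : groupType) := gen_choiceMixin (wreath F E).

Section Wreath.
Variables F E : groupType.
Local Open Scope group_scope.

Definition wreath_mul (u v : wreath F E) : wreath F E :=
  (u.1 * v.1, fun x => u.2 x * v.2 (x * u.1)).
Definition wreath_one : wreath F E := (1, fun=> 1).
Definition wreath_inv (u : wreath F E) : wreath F E :=
  (u.1^-1, fun x => (u.2 (x / u.1))^-1).

Fact wreath_mulA : associative wreath_mul.
Proof.
move=> u v w; congr pair; first exact: mulgA.
by apply: funext => x /=; rewrite !mulgA.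
Qed.

Fact wreath_mul1 : left_id wreath_one wreath_mul.
Proof.
case=> g e; congr pair; first exact: mul1g.
by apply: funext => x /=; rewrite mul1g mulg1.
Qed.

Fact wreath_mulr1 : right_id wreath_one wreath_mul.
Proof.
case=> g e; congr pair; first exact: mulg1.
by apply: funext => x /=; rewrite mulg1.
Qed.

Fact wreath_mulV : left_inverse wreath_one wreath_inv wreath_mul.
Proof.
case=> g e; congr pair; first exact: mulVg.
by apply: funext => x /=; rewrite mulVg.
Qed.

Fact wreath_mulrV : right_inverse wreath_one wreath_inv wreath_mul.
Proof.
case=> g e; congr pair; first exact: mulgV.
by apply: funext => x /=; rewrite mulgK mulgV.
Qed.

HB.instance Definition _ := isGroup.Build (wreath F E)
  wreath_mulA wreath_mul1 wreath_mulr1 wreath_mulV wreath_mulrV.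

Definition wreath_base (u : wreath F E) : F := u.1.

Fact wreath_baseM : {morph wreath_base : u v / u * v}.
Proof. by []. Qed.

HB.instance Definition _ :=
  isMultiplicative.Build (wreath F E) F wreath_base wreath_baseM.

Lemma wreathM2 (u v : wreath F E) x : (u * v).2 x = u.2 x * v.2 (x * u.1).
Proof. by []. Qed.

Lemma wreathV2 (u : wreath F E) x : u^-1.2 x = (u.2 (x / u.1))^-1.
Proof. by []. Qed.

End Wreath.

Lemma transversal (G : groupType) (T : normal_subgroup G) :
  exists t : G -> G, [/\ t 1%g = 1%g,
    forall u x, T u -> t (u * x)%g = t x & forall x, T (t x / x)%g].
Proof.
(* The chosen representative of [T] need not be [1]; dividing by it, an element of [T], normalises
   [t 1] without changing cosets. *)
exists (fun g => ((repr (cosetg T 1))^-1 * repr (cosetg T g))%g).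
split=> [|u x Tu|x]; first by rewrite mulVg.
  by congr (_ * repr _)%g; apply/cosetgP; rewrite mulgK.
rewrite -mulgA; apply: nsetM; last exact: repr_cosetg.
by apply: nsetV; have := repr_cosetg T 1%g; rewrite divg1.
Qed.

(** [s] is read off the coordinate at [1] of a section of a subgroup of the
    wreath product over [F]; the coordinates at [x] of that subgroup lie over
    the cocycle [t x * g / t (x * g)], where [t] is a transversal of [T]. *)
Lemma normal_lift (F : groupType) (T : normal_subgroup F) (E A : groupType)
    (pi : {multiplicative E -> A}) (E0 : set E) (f : F -> A) :
  free_group F -> is_subgroup E0 ->
  (forall x y, T x -> T y -> f (x * y)%g = (f x * f y)%g) ->
  (forall x, T x -> exists2 e, E0 e & pi e = f x) ->
  exists s : F -> E,
    (forall x y, T x -> T y -> s (x * y)%g = (s x * s y)%g) /\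
    (forall x, T x -> E0 (s x) /\ pi (s x) = f x).
Proof.
move=> freeF [E01 E0F] fM f_surj.
have f1 : f 1%g = 1%g.
  by apply: (mulgI (f 1%g)); rewrite -fM ?mulg1 //; exact: nset1.
have fV x : T x -> f (x^-1)%g = ((f x)^-1)%g.
  move=> Tx; apply: (mulgI (f x)); rewrite -fM ?mulgV ?f1 //; exact: nsetV.
have [t [t1 tT tN]] := transversal T.
have tt x g : t (t x * g)%g = t (x * g)%g.
  by rewrite -(tT (t x / x)%g (x * g)%g (tN x)) mulgA mulgVK.
pose c x g := (t x * g / t (x * g))%g.
have cT x g : T (c x g).
  have -> : c x g = ((t x / x) * (t (x * g) / (x * g))^-1)%g.
    by rewrite /c invgF !mulgA mulgVK.
  by apply: nsetM => //; exact: nsetV.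
have cF x g g' : c x (g / g')%g = (c x g / c (x * (g / g')) g')%g.
  have yE : (x * (g / g') * g')%g = (x * g)%g by rewrite -mulgA mulgVK.
  by rewrite /c yE invgF invgM !mulgA mulgVK.
(* The coordinates lie in [E0] over the cocycle [c] and are constant on the cosets of [T]. The
   values of [c] are in [T], where [f] is multiplicative and has lifts. *)
pose W0 := [set w : wreath F E |
  (forall x, E0 (w.2 x) /\ pi (w.2 x) = f (c x w.1)) /\
  (forall u x, T u -> w.2 (u * x)%g = w.2 x)].
have sW0 : is_subgroup W0.
  split=> [|v w [vE vT] [wE wT]].
    split=> // x; split; first exact: E01.
    by rewrite mulf1 /c /= !mulg1 mulgV f1.
  split=> [x|u x Tu]; rewrite wreathM2 wreathV2 /=; last first.
    by rewrite vT // -!mulgA wT.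
  have [vE0 vpi] := vE x; have [wE0 wpi] := wE (x * v.1 / w.1)%g.
  split; first exact: E0F.
  rewrite gmulfM Defs.mulfV vpi wpi -fV // -fM ?cF ?mulgA //; exact: nsetV.
have W0_surj g : exists2 w, W0 w & wreath_base w = g.
  have /choice[e eP] x : exists e, E0 e /\ pi e = f (c x g).
    by have [e E0e pe] := f_surj _ (cT x g); exists e.
  exists (g, fun x => e (t x)) => //; split=> [x|u x Tu] /=; last by rewrite tT.
  have [E0e ->] := eP (t x); split=> //; congr (f _).
  by rewrite /c tt -[X in t X]mulg1 tt mulg1.
have [h hP] := free_lift freeF sW0 W0_surj.
(* The product rule shifts the second factor to its coordinate at [x], which equals the one at [1]
   because [x] is in [T]. Moreover [c 1 x = x] by the normalisation of [t]. *)
exists (fun x => (h x).2 1%g); split=> [x y Tx Ty|x Tx].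
  rewrite gmulfM wreathM2; congr (_ * _)%g; have [[_ yT] _] := hP y.
  by rewrite -[(h x).1]/(wreath_base (h x)) (hP x).2 mul1g -[x]mulg1 yT.
have [[/(_ 1%g) [E0x pix] _] hx] := hP x; split=> //.
rewrite pix -[(h x).1]/(wreath_base (h x)) hx /c mul1g t1 mul1g.
by rewrite -[X in t X]mulg1 tT // t1 divg1.
Qed.

(** * Abelian subquotients and abelianizations *)

Section AbelianSubquotient.
Variables (G : groupType) (H K : normal_subgroup G).

Lemma subquot_comm : (forall x y, H x -> H y -> K [~ x, y]%g) ->
  commutative_group (subquot H K).
Proof.
move=> HK u v; rewrite -(reprgK u) -(reprgK v) -!gmulfM; apply/cosetgP => /=.
set x := val _; set y := val _.
have -> : (x * y / (y * x) = [~ x^-1, y^-1])%g.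
  by rewrite /commg /conjg !invgK invgM !mulgA.
by apply: HK; apply: nsetV; exact: subgP.
Qed.

Variable HKC : commutative_group (subquot H K).
Local Notation A := (additive_of HKC).

(** The class of [x] in [H / K], and [0] outside [H]. *)
Definition cls (x : G) : A :=
  match pselect (H x) with
  | left Hx => cosetg (restrictg H K) (Subg Hx)
  | right _ => 0
  end.

Lemma clsE x (Hx : H x) : cls x = cosetg (restrictg H K) (Subg Hx).
Proof.
rewrite /cls; case: pselect => // Hx'; congr (cosetg _ _).
exact: val_inj.
Qed.

Lemma clsM x y : H x -> H y -> cls (x * y)%g = cls x + cls y.
Proof.
move=> Hx Hy; rewrite (clsE (nsetM Hx Hy)) (clsE Hx) (clsE Hy).
rewrite -[RHS]/(cosetg (restrictg H K) (Subg Hx) * cosetg (restrictg H K) (Subg Hy))%g.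
by rewrite -gmulfM; congr (cosetg _ _); exact: val_inj.
Qed.

Lemma cls_eq x y : H x -> H y -> cls x = cls y <-> K (x / y)%g.
Proof. by move=> Hx Hy; rewrite (clsE Hx) (clsE Hy) cosetgP. Qed.

Lemma cls_eq0 x : H x -> cls x = 0 <-> K x.
Proof.
move=> Hx; have cls1 : cls 1%g = 0.
  by apply: (addrI (cls 1%g)); rewrite -clsM ?mulg1 ?addr0 //; exact: nset1.
by rewrite -cls1 cls_eq ?divg1 //; exact: nset1.
Qed.

Lemma clsV x : H x -> cls (x^-1)%g = - cls x.
Proof.
move=> Hx; apply: (addrI (cls x)); rewrite -clsM ?mulgV ?subrr //; last exact: nsetV.
by apply/cls_eq0; exact: nset1.
Qed.

Lemma cls_surj a : exists2 x, H x & a = cls x.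
Proof.
exists (val (repr (a : subquot H K))); first exact: subgP.
rewrite (clsE (subgP _)) -[LHS](reprgK (a : subquot H K)).
by congr (cosetg _ _); exact: val_inj.
Qed.

Lemma cls_lift (V : zmodType) (f : G -> V) :
  (forall x y, H x -> H y -> f (x * y)%g = f x + f y) ->
  (forall x, H x -> K x -> f x = 0) ->
  exists g : {additive A -> V}, forall x, H x -> g (cls x) = f x.
Proof.
move=> fM fK; have /choice[r rP] a : exists x, H x /\ a = cls x.
  by have [x Hx ->] := cls_surj a; exists x.
have fcls x y : H x -> H y -> cls x = cls y -> f x = f y.
  move=> Hx Hy /cls_eq Kxy; rewrite -[x](mulgVK y) fM //; last exact: nsetF.
  by rewrite fK ?add0r //; [exact: nsetF|exact: Kxy].
have gD : {morph (fun a => f (r a)) : a b / a + b}.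
  move=> a b; have [[Ha aE] [Hb bE]] := (rP a, rP b).
  have [Hab abE] := rP (a + b); rewrite -fM //; apply: fcls => //.
    exact: nsetM.
  by rewrite -abE {1}aE {1}bE clsM.
exists (addmor gD) => x Hx; have [Hr rE] := rP (cls x).
by apply: fcls.
Qed.

End AbelianSubquotient.

Section Derived.
Variable G : groupType.
Implicit Types H K : normal_subgroup G.

Lemma mem_commsg H K x y : H x -> K y -> commsg H K [~ x, y]%g.
Proof. by move=> Hx Ky; apply: sub_gen_smallest; exists x, y. Qed.

Lemma commsg_sub_ind H K (N : set G) : is_subgroup N ->
  (forall x y, H x -> K y -> N [~ x, y]%g) -> commsg H K `<=` N.
Proof. by move=> sN NHK; apply: smallest_sub => // _ [x [y [Hx Ky ->]]]; exact: NHK. Qed.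

(** Applied to differences, this reduces an equality on a commutator subgroup to commutators.
    Additivity is asked only there, since [kap] is additive on [T'] but in general not on [T]. *)
Lemma commsg_add_ind (V : zmodType) H K (f : G -> V) :
  (forall x y, commsg H K x -> commsg H K y -> f (x * y)%g = f x + f y) ->
  (forall x y, H x -> K y -> f [~ x, y]%g = 0) ->
  forall x, commsg H K x -> f x = 0.
Proof.
move=> fM f0; have f1 : f 1%g = 0.
  by apply: (addrI (f 1%g)); rewrite -fM ?mulg1 ?addr0 //; exact: nset1.
suff h : commsg H K `<=` [set x | commsg H K x /\ f x = 0] by move=> x /h[].
apply: commsg_sub_ind; last by move=> x y Hx Ky; split; [exact: mem_commsg|exact: f0].
split=> [|x y [Nx fx] [Ny fy]]; first by split; [exact: nset1|].
split; first exact: nsetF.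
have NV := nsetV Ny; rewrite fM // fx add0r.
by apply: (addrI (f y)); rewrite -fM // mulgV f1 fy addr0.
Qed.

Lemma derivedg_sub H : derivedg H `<=` H.
Proof.
by apply: commsg_sub_ind; [case: (nsetP H)|move=> x y Hx _; exact: nsetRl].
Qed.

Lemma commsg_mono H K H' K' : H `<=` H' -> K `<=` K' -> commsg H K `<=` commsg H' K'.
Proof.
move=> HH' KK'; apply: commsg_sub_ind; first by case: (nsetP (commsg H' K')).
by move=> x y /HH' Hx /KK' Ky; exact: mem_commsg.
Qed.

Fact derived_comm H : commutative_group (subquot H (derivedg H)).
Proof. by apply: subquot_comm => x y; exact: mem_commsg. Qed.

Definition ab H : zmodType := additive_of (@derived_comm H).
Definition clab H : G -> ab H := cls (@derived_comm H).

Lemma clabM H x y : H x -> H y -> clab H (x * y)%g = clab H x + clab H y.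
Proof. exact: clsM. Qed.

Lemma clab_eq0 H x : H x -> clab H x = 0 <-> derivedg H x.
Proof. exact: cls_eq0. Qed.

Lemma clabV H x : H x -> clab H (x^-1)%g = - clab H x.
Proof. exact: clsV. Qed.

Lemma clabJ H x g : H x -> H g -> clab H (x ^ g)%g = clab H x.
Proof.
move=> Hx Hg; have HV := nsetV Hg.
rewrite /conjg clabM ?clabM ?clabV //; last exact: nsetM.
by rewrite addrC addrK.
Qed.

End Derived.

Local Notation to_multiplicative := Algebra.to_multiplicative.

Section MulOfAdditive.
Variables (V W : zmodType) (f : {additive V -> W}).

Definition mulmap : to_multiplicative V -> to_multiplicative W := f.

Fact mulmapM : {morph mulmap : x y / (x * y)%g}.
Proof. by move=> x y; exact: (raddfD f). Qed.

HB.instance Definition _ := isMultiplicative.Build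
  (to_multiplicative V) (to_multiplicative W) mulmap mulmapM.
End MulOfAdditive.

Fact is_subgroup_setT (G : groupType) : is_subgroup [set: G].
Proof. by []. Qed.

(** The class map lifts through the free cover to a homomorphism on [H]; its target is abelian, so
    it kills [H'] and descends to a section. *)
Lemma projective_ab (F : groupType) (H : normal_subgroup F) :
  free_group F -> projective (ab H).
Proof.
move=> freeF.
have [|x Hx|s [sM sE]] := @normal_lift F H _ _ (mulmap (@free_cover (ab H)))
    [set: to_multiplicative {malg ab H}] (clab H) freeF (is_subgroup_setT _).
- exact: clabM.
- by exists << clab H x >> => //; exact: zliftU.
have sD x y : H x -> H y -> s (x * y)%g = s x + s y :> {malg ab H} by exact: sM.
have H'H := @derivedg_sub _ H.
have s1 : s 1%g = 0 :> {malg ab H}.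
  by apply: (addrI (s 1%g : {malg ab H})); rewrite -sD ?mulg1 ?addr0 //; exact: nset1.
have sV x : H x -> s (x^-1)%g = - (s x : {malg ab H}) :> {malg ab H}.
  move=> Hx; apply: (addrI (s x : {malg ab H})).
  by rewrite -sD ?mulgV ?s1 ?subrr //; exact: nsetV.
have [x _|g gE] := @cls_lift _ _ _ (@derived_comm _ H) {malg ab H} s sD.
  move: x; apply: commsg_add_ind => [x y /H'H Hx /H'H Hy|x y Hx Hy]; first exact: sD.
  have [HxV HyV] := (nsetV Hx, nsetV Hy).
  have HM := nsetM Hy Hx; have HMV := nsetV HM.
  have -> : ([~ x, y] = (y * x)^-1 * (x * y))%g by rewrite /commg /conjg invgM !mulgA.
  by rewrite sD ?sV ?sD ?[_ (s y) _]addrC ?addNr //; exact: nsetM.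
exists g => a; have [x Hx ->] := cls_surj a.
by rewrite gE //; have [_ /= ->] := sE x Hx.
Qed.

(** The Heisenberg group of [P]: commutators lift to antisymmetric tensors. *)
Definition heis (P : zmodType) : Type := (P * tensor P P)%type.

HB.instance Definition _ (P : zmodType) := Choice.on (heis P).

Section Heisenberg.
Variable P : zmodType.

Definition heis_mul (u v : heis P) : heis P :=
  (u.1 + v.1, u.2 + v.2 + tens u.1 v.1).
Definition heis_one : heis P := (0, 0).
Definition heis_inv (u : heis P) : heis P := (- u.1, tens u.1 u.1 - u.2).

Fact heis_mulA : associative heis_mul.
Proof.
move=> u v w; rewrite /heis_mul /= tensDl tensDr !addrA; congr (_, _).
rewrite -!addrA; do 2![congr (_ + _)]; rewrite [RHS]addrCA; congr (_ + _).
by rewrite addrC -addrA.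
Qed.

Fact heis_mul1 : left_id heis_one heis_mul.
Proof. by case=> a z; rewrite /heis_mul /= tens0l !add0r addr0. Qed.

Fact heis_mulr1 : right_id heis_one heis_mul.
Proof. by case=> a z; rewrite /heis_mul /= tens0r !addr0. Qed.

Fact tensNr (a b : P) : tens a (- b) = - tens a b.
Proof. by rewrite -[- b]add0r tensBr tens0r add0r. Qed.

Fact tensNl (a b : P) : tens (- a) b = - tens a b.
Proof. by rewrite -[- a]add0r tensBl tens0l add0r. Qed.

Fact heis_mulV : left_inverse heis_one heis_inv heis_mul.
Proof. by case=> a z; rewrite /heis_mul /= tensNl subrK addNr subrr. Qed.

Fact heis_mulrV : right_inverse heis_one heis_inv heis_mul.
Proof.
by case=> a z; rewrite /heis_mul /= tensNr [z + _]addrC subrK !subrr.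
Qed.

HB.instance Definition _ := isGroup.Build (heis P)
  heis_mulA heis_mul1 heis_mulr1 heis_mulV heis_mulrV.

Definition heis_fst (u : heis P) : to_multiplicative P := u.1.

Fact heis_fstM : {morph heis_fst : u v / (u * v)%g}.
Proof. by []. Qed.

HB.instance Definition _ :=
  isMultiplicative.Build (heis P) (to_multiplicative P) heis_fst heis_fstM.

(** [k] is the tensor coordinate of a lift of [cl]; where [cl] vanishes, it is additive. *)
Lemma heis_lift (F : groupType) (T : normal_subgroup F) (cl : F -> P) :
  free_group F -> (forall x y, T x -> T y -> cl (x * y)%g = cl x + cl y) ->
  exists k : F -> tensor P P,
    forall x y, T x -> T y -> k (x * y)%g = k x + k y + tens (cl x) (cl y).
Proof.
move=> freeF clM.
have [|x Tx|s [sM sE]] := @normal_lift F T _ _ heis_fst [set: heis P] cl freeF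
    (is_subgroup_setT _).
- exact: clM.
- by exists (cl x, 0).
exists (fun x => (s x).2) => x y Tx Ty; rewrite sM //.
have [_ <-] := sE x Tx; by have [_ <-] := sE y Ty.
Qed.

End Heisenberg.

(** * A function on [F] detecting the pairing of [R] and [S] *)

Section Pairing.
Variables (F : groupType) (R S : normal_subgroup F) (A B : zmodType).
Variables (clR : F -> A) (clS : F -> B).
Hypothesis clRM : forall x y, R x -> R y -> clR (x * y)%g = clR x + clR y.
Hypothesis clSM : forall x y, S x -> S y -> clS (x * y)%g = clS x + clS y.

Lemma transversal_extension : exists theta : F -> A,
  forall w g, R w -> theta (w * g)%g = clR w + theta g.
Proof.
have [t [_ tR tN]] := transversal R; exists (fun g => clR (g / t g)%g) => w g Rw.
have Rg : R (g / t g)%g by rewrite -invgF; apply: nsetV.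
by rewrite tR // -mulgA; exact: clRM.
Qed.

(** The defining identity says that the additive extension of [lam] sends
    [(w - 1) g (y - 1)] to the class of [w] tensor that of [y]. *)
Lemma pairing_extension : free_group F -> exists lam : F -> tensor A B,
  forall w g y, R w -> S y ->
    lam (w * g * y)%g - lam (w * g)%g - (lam (g * y)%g - lam g) =
    tens (clR w) (clS y).
Proof.
move=> freeF; have [theta thetaM] := transversal_extension.
pose E := wreath F (to_multiplicative (tensor A B)).
(* Each [y] in [S] is to receive a function of [g] whose left difference along [w] is
   [clR w (x) clS y]. The functions [theta g (x) clS y] have this difference but need not obey the
   wreath product rule; lifting the inclusion of [S] into [E0] yields functions that do. *)
pose E0 := [set u : E | S u.1 /\ forall w g, R w ->
  (u.2 (w * g)%g : tensor A B) = tens (clR w) (clS u.1) + (u.2 g : tensor A B)].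
have clS1 : clS 1%g = 0.
  by apply: (addrI (clS 1%g)); rewrite -clSM ?mulg1 ?addr0 //; exact: nset1.
have sE0 : is_subgroup E0.
  split=> [|u v [Su uE] [Sv vE]].
    by split=> [|w g Rw] /=; [exact: nset1|rewrite clS1 tens0r add0r].
  split=> [|w g Rw]; first exact: nsetF.
  have mE (x y : to_multiplicative (tensor A B)) :
    (x / y)%g = (x : tensor A B) - (y : tensor A B) by [].
  rewrite !wreathM2 !wreathV2 !mE uE // -!mulgA vE //.
  have -> : clS (u.1 * v.1^-1)%g = clS u.1 - clS v.1.
    apply: (addIr (clS v.1)); rewrite -clSM ?mulgVK ?subrK //; exact: nsetF.
  by rewrite tensBr opprD addrACA.
have [//|x Sx|s [sM sE]] := @normal_lift F S E F (@wreath_base _ _) E0 id freeF sE0.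
  exists (x, fun g => tens (theta g) (clS x)) => //; split=> // w g Rw /=.
  by rewrite thetaM // tensDl.
have [t [_ tS tN]] := transversal S.
pose psi y g : tensor A B := (s y).2 g.
have psiM x y g : S x -> S y -> psi (x * y)%g g = psi x g + psi y (g * x)%g.
  move=> Sx Sy; rewrite /psi sM // wreathM2; have [_] := sE x Sx.
  by rewrite /wreath_base => ->.
have psiR y w g : S y -> R w -> psi y (w * g)%g = tens (clR w) (clS y) + psi y g.
  move=> Sy Rw; have [[_ h] sy] := sE y Sy; rewrite /psi h //.
  by rewrite -[(s y).1]/(wreath_base (s y)) sy.
have Stg g : S ((t g)^-1 * g)%g.
  have -> : ((t g)^-1 * g)%g = ((t g / g)^-1 ^ t g)%g.
    by rewrite invgF conjgE !mulgA mulgVK.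
  by apply: nsetJ; apply: nsetV.
have tSr g y : S y -> t (g * y)%g = t g.
  move=> Sy; have -> : (g * y = y ^ (g^-1) * g)%g by exact: conjgCV.
  by apply: tS; exact: nsetJ.
(* This sums the cocycle [psi] from the coset representative to [g], so that
   [lam (g * y) - lam g = psi y g] for [y] in [S]. *)
pose lam g := psi ((t g)^-1 * g)%g (t g).
have lamS g y : S y -> lam (g * y)%g = lam g + psi y g.
  by move=> Sy; rewrite /lam tSr // mulgA psiM // mulVKg.
exists lam => w g y Rw Sy; rewrite (lamS (w * g)%g y Sy) (lamS g y Sy) psiR //.
by rewrite [lam (w * g)%g + _]addrC addrK [lam g + _]addrC !addrK.
Qed.

End Pairing.

(** * The ideal r f s and its normal subgroup *)

Section RelIdeal.
Variables (F : groupType) (H : normal_subgroup F).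

(** By normality [g (w - 1) = (w' - 1) g] with [w'] conjugate to [w], so the elements [(w - 1) g]
    already span a two-sided ideal. *)
Lemma rel_ideal_indl (Pr : group_ring F -> Prop) :
  Pr 0 -> (forall u v, Pr u -> Pr v -> Pr (u - v)) ->
  (forall w g, H w -> Pr ((gr w - 1) * gr g)) ->
  forall u, rel_ideal H u -> Pr u.
Proof.
move=> P0 PB Pgen.
pose X := [set u : group_ring F | exists w g, H w /\ u = (gr w - 1) * gr g].
have [s0 sB] := smallest_addsubgroup X.
have sN u : smallest (@is_addsubgroup _) X u -> smallest (@is_addsubgroup _) X (- u).
  by move=> su; rewrite -sub0r; exact: sB.
have iX : is_ideal (smallest (@is_addsubgroup (group_ring F)) X).
  split=> // a x; move: a x; apply: gr_ind => [x _|g|u v hu hv x sx];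
    rewrite ?mul0r ?mulr0 ?mulrBl ?mulrBr //; try by apply: sB; [exact: hu|exact: hv].
  - suff h : smallest (@is_addsubgroup _) X `<=`
        [set x | smallest (@is_addsubgroup _) X (gr g * x)] by move=> x /h.
    apply: smallest_sub.
      by split=> [|x y]; rewrite /= ?mulr0 ?mulrBr //; exact: sB.
    move=> _ [w [g' [Hw ->]]] /=; apply: sub_gen_smallest.
    exists (w ^ (g^-1))%g, (g * g')%g; split; first exact: nsetJ.
    rewrite mulrA mulrBr mulr1 !mulrBl !mul1r -!grM; congr (gr _ - _).
    by rewrite /conjg invgK !mulgA mulgVK.
  - suff h : smallest (@is_addsubgroup _) X `<=`
        [set x | smallest (@is_addsubgroup _) X (x * gr g)] by move=> x /h.
    apply: smallest_sub.
      by split=> [|x y]; rewrite /= ?mul0r ?mulrBl //; exact: sB.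
    move=> _ [w [g' [Hw ->]]] /=; apply: sub_gen_smallest.
    by exists w, (g' * g)%g; rewrite -mulrA -grM.
suff h : rel_ideal H `<=` Pr by [].
apply: (@subset_trans _ (smallest (@is_addsubgroup _) X)).
  apply: smallest_sub => // _ [w Hw ->]; apply: sub_gen_smallest.
  by exists w, 1%g; rewrite gr1 mulr1.
by apply: smallest_sub => // _ [w [g [Hw ->]]]; exact: Pgen.
Qed.

Lemma rel_ideal_indr (Pr : group_ring F -> Prop) :
  Pr 0 -> (forall u v, Pr u -> Pr v -> Pr (u - v)) ->
  (forall g w, H w -> Pr (gr g * (gr w - 1))) ->
  forall u, rel_ideal H u -> Pr u.
Proof.
move=> P0 PB Pgen; apply: rel_ideal_indl => // w g Hw.
have -> : (gr w - 1) * gr g = gr g * (gr (w ^ g)%g - 1).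
  by rewrite mulrBl mulrBr mul1r mulr1 -!grM -conjgC.
by apply: Pgen; exact: nsetJ.
Qed.

Lemma dimg_rel_ideal w : rel_ideal H (gr w - 1) -> H w.
Proof.
move=> rw; have /(_ _ rw) : forall u, rel_ideal H u -> gr_map (cosetg H) u = 0.
  apply: rel_ideal_indl => [|u v u0 v0|x g Hx]; first exact: gr_map0.
    by rewrite gr_mapB u0 v0 subrr.
  rewrite mulrBl mul1r -grM gr_mapB !gr_map_gr.
  apply/eqP; rewrite subr_eq0; apply/eqP; congr gr.
  by apply/cosetgP; rewrite mulgK.
rewrite gr_mapB -gr1 !gr_map_gr => /eqP; rewrite subr_eq0 => /eqP.
move=> /(congr1 (mcoeff (cosetg H w))); rewrite !mcoeffU eqxx.
by case: eqP => [/esym/cosetgP|//]; rewrite divg1.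
Qed.

End RelIdeal.

Lemma idealM_subl (A : nzRingType) (I J : ideal A) : idealM I J `<=` I.
Proof.
apply: smallest_sub; first by split; [exact: iset0|exact: isetB].
by move=> _ [x [y [Ix _ ->]]]; exact: isetMr.
Qed.

Lemma idealM_subr (A : nzRingType) (I J : ideal A) : idealM I J `<=` J.
Proof.
apply: smallest_sub; first by split; [exact: iset0|exact: isetB].
by move=> _ [x [y [_ Jy ->]]]; exact: isetMl.
Qed.

Section RFS.
Variables (F : groupType) (R S : normal_subgroup F).
Local Notation rfs :=
  (idealM (idealM (rel_ideal R) (rel_ideal (fullg F))) (rel_ideal S)).
Local Notation T := (capg R S).

Lemma rfs_group_cap w : rfs_group R S w -> T w.
Proof.
move=> rw; split; apply: dimg_rel_ideal.
  exact: (idealM_subl (idealM_subl rw)).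
exact: (idealM_subr rw).
Qed.

Lemma gr_rect (w g y : F) : (gr w - 1) * gr g * (gr y - 1) =
  gr (w * g * y)%g - gr (w * g)%g - (gr (g * y)%g - gr g).
Proof.
rewrite mulrBl mul1r mulrBr mulr1 mulrBl -!grM !opprB addrACA [RHS]addrACA.
by congr (_ + _); exact: addrC.
Qed.

(** The middle factor [h - 1] makes a product the difference of two elements [(w - 1) g (y - 1)]
    with the same [w] and [y], on which [L] takes the same value. *)
Lemma rfs_vanish (V : zmodType) (L : {additive group_ring F -> V}) (c : F -> F -> V) :
  (forall w g y, R w -> S y -> L ((gr w - 1) * gr g * (gr y - 1)) = c w y) ->
  forall u, rfs u -> L u = 0.
Proof.
move=> Lc.
suff h : rfs `<=` [set u | L u = 0] by [].
apply: smallest_sub.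
  by split=> [|x y]; rewrite /= ?raddf0 ?raddfB // => -> ->; rewrite subr0.
move=> _ [u [v [ru sv ->]]]; move: v sv.
apply: rel_ideal_indr => [|v v' h h'|k y Sy].
- by rewrite /= mulr0 raddf0.
- by rewrite /= mulrBr raddfB h h' subr0.
move: u ru; suff h : idealM (rel_ideal R) (rel_ideal (fullg F)) `<=`
  [set u | L (u * (gr k * (gr y - 1))) = 0] by [].
apply: smallest_sub.
  split=> [|u u']; rewrite /= ?mul0r ?raddf0 // mulrBl raddfB => -> ->.
  by rewrite subr0.
move=> _ [a [b [ra fb ->]]] /=; move: a ra.
apply: rel_ideal_indl => [|a a' h h'|w g Rw].
- by rewrite !mul0r raddf0.
- by rewrite !mulrBl raddfB h h' subr0.
move: b fb; apply: rel_ideal_indl => [|b b' h h'|h g' _].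
- by rewrite mulr0 !mul0r raddf0.
- by rewrite mulrBr !mulrBl raddfB /= -!mulrBl h h' subr0.
have -> : (gr w - 1) * gr g * ((gr h - 1) * gr g') * (gr k * (gr y - 1)) =
    (gr w - 1) * gr (g * h * g' * k)%g * (gr y - 1) -
    (gr w - 1) * gr (g * g' * k)%g * (gr y - 1).
  rewrite -mulrBl -mulrBr !mulrA; congr (_ * _); rewrite -!mulrA; congr (_ * _).
  by rewrite mulrBl mul1r mulrBr !grM !mulrA.
by rewrite raddfB !Lc // subrr.
Qed.

(** The separating function vanishes off [R S] and is
    [theta y - theta (w^-1)] at [w y]. *)
Lemma rfs_group_derived w : rfs_group R S w -> derivedg T w.
Proof.
move=> rw; have Tw := rfs_group_cap rw; apply/(clab_eq0 Tw).
have [theta thetaM] := transversal_extension (@clabM _ T).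
pose mu g : ab T := match pselect (exists p : F * F, [/\ R p.1, S p.2 & g = (p.1 * p.2)%g]) with
  | left e => let p := projT1 (cid e) in theta p.2 - theta (p.1^-1)%g
  | right _ => 0
  end.
have muE x y : R x -> S y -> mu (x * y)%g = theta y - theta (x^-1)%g.
  move=> Rx Sy; rewrite /mu; case: pselect => [e|]; last by case; exists (x, y).
  case: cid => -[x' y'] /= [Rx' Sy' xyE].
  (* Two factorizations differ by some [t] in [T], which adds [clab T t] to both values of
     [theta]. *)
  have [t [Tt -> ->]] : exists t, [/\ T t, y' = (t * y)%g & (x'^-1 = t * x^-1)%g].
    exists (x'^-1 * x)%g; split.
    + split; first by apply: nsetM => //; exact: nsetV.
      have -> : (x'^-1 * x = y' / y)%g.
        by apply: (mulgI x'); rewrite mulVKg mulgA -xyE mulgK.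
      exact: nsetF.
    + by rewrite -mulgA xyE mulKg.
    + by rewrite mulgK.
  by rewrite !thetaM // opprD addrACA subrr add0r.
have mu0 g : ~ prodg R S g -> mu g = 0.
  by move=> nRS; rewrite /mu; case: pselect => // -[[x y] /= h]; case: nRS; exists x, y.
pose L : {additive group_ring F -> ab T} := zlift mu.
have LE g : L (gr g) = mu g by exact: zliftU.
(* On [R S] the function is a sum of one part for each factor, so its mixed difference vanishes; if
   [g] is outside [R S], so are all four points. *)
have L0 x g y : R x -> S y -> L ((gr x - 1) * gr g * (gr y - 1)) = 0.
  move=> Rx Sy; rewrite gr_rect !(raddfB L) !LE.
  have RSx : prodg R S x by exists x, 1%g; rewrite mulg1; split=> //; exact: nset1.
  have RSy : prodg R S y by exists 1%g, y; rewrite mul1g; split=> //; exact: nset1.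
  have [[x' [y' [Rx' Sy' ->]]]|nRS] := pselect (prodg R S g).
    rewrite -!mulgA !(mulgA x x').
    have [Rxx Syy] := (nsetM Rx Rx', nsetM Sy' Sy).
    by rewrite !muE // !opprB !addrA !subrK subrr.
  have nxg : ~ prodg R S (x * g)%g.
    by move=> h; apply: nRS; rewrite -(mulKg x g); apply: nsetM => //; exact: nsetV.
  have ngy : ~ prodg R S (g * y)%g.
    by move=> h; apply: nRS; rewrite -(mulgK y g); exact: nsetF.
  have nxgy : ~ prodg R S (x * g * y)%g.
    by move=> h; apply: nxg; rewrite -(mulgK y (x * g)%g); exact: nsetF.
  by rewrite !mu0 // !subr0.
have := @rfs_vanish _ L (fun _ _ => 0) L0 _ rw.
have [Rw Sw] := Tw.
have muw : mu w = clab T w + mu 1%g.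
  rewrite -[X in mu X = _]mul1g -[X in _ + mu X]mul1g.
  rewrite !muE //; try exact: nset1.
  by rewrite -[X in theta X - _]mulg1 thetaM // addrA.
by rewrite raddfB -gr1 !LE muw addrK.
Qed.

Section Kappa.
Variables (P : zmodType) (cl : F -> P) (k : F -> tensor P P).
Variables (q1 : {additive P -> ab R}) (q2 : {additive P -> ab S}).
Hypothesis cl_derived : forall x, derivedg T x -> cl x = 0.
Hypothesis kM : forall x y, T x -> T y ->
  k (x * y)%g = k x + k y + tens (cl x) (cl y).
Hypothesis q1E : forall x, T x -> q1 (cl x) = clab R x.
Hypothesis q2E : forall x, T x -> q2 (cl x) = clab S x.

Lemma kR x y : T x -> T y -> k [~ x, y]%g = tens (cl x) (cl y) - tens (cl y) (cl x).
Proof.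
move=> Tx Ty; have TR : T [~ x, y]%g by apply: nsetRl.
have clR0 : cl [~ x, y]%g = 0 by apply: cl_derived; exact: mem_commsg.
have Tyx := nsetM Ty Tx.
have e : k x + k y + tens (cl y) (cl x) + k [~ x, y]%g = k x + k y + tens (cl x) (cl y).
  rewrite -(kM Tx Ty) commgC (kM Tyx TR) clR0 tens0r addr0 (kM Ty Tx).
  by rewrite [k x + _]addrC.
apply: (addrI (k x + k y + tens (cl y) (cl x))); rewrite e -[RHS]addrA.
by congr (_ + _); rewrite addrC subrK.
Qed.

Lemma k_derived x y : derivedg T x -> derivedg T y -> k (x * y)%g = k x + k y.
Proof.
move=> T'x T'y; rewrite kM; [|exact: derivedg_sub|exact: derivedg_sub].
by rewrite cl_derived // tens0l addr0.
Qed.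

Lemma derived_capR : derivedg T `<=` derivedg R.
Proof. by apply: commsg_mono => x []. Qed.

Lemma derived_capS : derivedg T `<=` derivedg S.
Proof. by apply: commsg_mono => x []. Qed.

Lemma grM_sub1 (x y : F) :
  gr (x * y)%g - 1 = (gr x - 1) + (gr y - 1) + (gr x - 1) * gr 1%g * (gr y - 1).
Proof.
rewrite gr_rect !mulg1 mul1g gr1 -[RHS]addrA [X in _ = _ + X]addrCA subrr addr0.
by rewrite [RHS]addrC addrA subrK.
Qed.

(** Conjugating moves the factor [x^-1 y^-1] to the middle, giving the shape [(w - 1) g (y - 1)] on
    which the functionals are known; for [x], [y] in [T] it does not change classes in the
    abelianization. *)
Lemma grR_sub1 (x y : F) : gr [~ x, y]%g - 1 =
  (gr (x ^ (y * x))%g - 1) * gr (x^-1 * y^-1)%g * (gr y - 1) -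
  (gr (y ^ (y * x))%g - 1) * gr (x^-1 * y^-1)%g * (gr x - 1).
Proof.
have gE u v : (u ^ (y * x) * (x^-1 * y^-1) * v = x^-1 * y^-1 * u * v)%g.
  by rewrite /conjg invgM !mulgA mulgK mulgK.
have gE1 u : (u ^ (y * x) * (x^-1 * y^-1) = x^-1 * y^-1 * u)%g.
  by rewrite -[LHS]mulg1 gE mulg1.
rewrite !gr_rect !gE !gE1.
have -> : (x^-1 * y^-1 * y * x = 1)%g by rewrite mulgVK mulVg.
have -> : [~ x, y]%g = (x^-1 * y^-1 * x * y)%g by rewrite /commg /conjg !mulgA.
have E (V : zmodType) (a b p q c : V) :
    a - p - (q - c) - (b - q - (p - c)) = a - b.
  have D (u v w : V) : u - v - w = u - (v + w) by rewrite [in RHS]opprD addrA.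
  by rewrite !(D _ _ (_ - c)) addrCA opprB [LHS]addrA subrK.
by rewrite gr1 E.
Qed.

(** For [x] in [T'], the element [x - 1] of [r s / r f s = Rab (x) Sab] is the
    image of the antisymmetric tensor [k x]. *)
Lemma rfs_groupP x : free_group F -> derivedg T x ->
  rfs_group R S x <-> tens_map q1 q2 (k x) = 0.
Proof.
move=> freeF T'x; split.
  (* On [T'], both [L (gr x - 1)] and the image of [k x] are additive in [x], and they agree on
     commutators; [L] vanishes on r f s. *)
  have [lam lamE] := pairing_extension (@clabM _ R) (@clabM _ S) freeF.
  pose L : {additive group_ring F -> tensor (ab R) (ab S)} := zlift lam.
  have LE g : L (gr g) = lam g by exact: zliftU.
  have L0 w g y : R w -> S y -> L ((gr w - 1) * gr g * (gr y - 1)) =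
      tens (clab R w) (clab S y).
    by move=> Rw Sy; rewrite gr_rect !(raddfB L) !LE lamE.
  move=> /(rfs_vanish L0) Lx.
  pose f x := L (gr x - 1) - tens_map q1 q2 (k x).
  have f0 : forall x, derivedg T x -> f x = 0.
    apply: commsg_add_ind => [a b T'a T'b|a b Ta Tb]; rewrite /f.
      have R'a := derived_capR T'a; have S'b := derived_capS T'b.
      have Ra := derivedg_sub R'a; have Sb := derivedg_sub S'b.
      rewrite grM_sub1 2!(raddfD L) L0 // (clab_eq0 Ra).2 // tens0l addr0.
      by rewrite k_derived // (raddfD (tens_map q1 q2)) opprD addrACA.
    have [[Ra Sa] [Rb Sb]] := (Ta, Tb).
    rewrite kR // (raddfB (tens_map q1 q2)) /= !tens_mapE !q1E // !q2E //.
    rewrite grR_sub1 (raddfB L).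
    have Rba := nsetM Rb Ra.
    rewrite !L0 ?clabJ ?subrr //; exact: nsetJ.
  by have /eqP := f0 x T'x; rewrite /f Lx sub0r oppr_eq0 => /eqP.
(* Conversely, [(w - 1)(y - 1)] modulo r f s induces [xi] on [Rab (x) Sab], and [xi] sends the image
   of [k x] to the class of [x - 1], again by comparison on commutators. *)
move=> qk; pose X : set (group_ring F) := rfs.
have sX : is_addsubgroup X by split; [exact: (iset0 rfs)|exact: (@isetB _ rfs)].
have [Y [piX piX0 piXK]] : exists Y : zmodType,
    exists2 piX : {additive group_ring F -> Y},
      forall u v, X (u - v) -> piX u = piX v & forall u, piX u = 0 -> X u.
  exists (zquot X), (zpi X) => [u v h|u]; last exact: zpi_eq0P.
  by apply/zpiP; exact: sub_gen_smallest.
have rf_s u y : idealM (rel_ideal R) (rel_ideal (fullg F)) u -> S y -> X (u * (gr y - 1)).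
  by move=> hu Sy; apply: idealM_mul => //; exact: rel_ideal_gr.
have r_fs w u : R w -> idealM (rel_ideal (fullg F)) (rel_ideal S) u -> X ((gr w - 1) * u).
  by move=> Rw hu; apply: idealM_mulA => //; exact: rel_ideal_gr.
have piD1 w w' y : R w -> R w' -> S y -> piX ((gr (w * w')%g - 1) * (gr y - 1)) =
    piX ((gr w - 1) * (gr y - 1)) + piX ((gr w' - 1) * (gr y - 1)).
  move=> Rw Rw' Sy; rewrite -raddfD; apply: piX0.
  rewrite -mulrDl -mulrBl grM_sub1 gr1 mulr1 [_ + _ * _]addrC addrK.
  by apply: rf_s => //; apply: idealM_mul; exact: rel_ideal_gr.
have piD2 w y y' : R w -> S y -> S y' -> piX ((gr w - 1) * (gr (y * y')%g - 1)) =
    piX ((gr w - 1) * (gr y - 1)) + piX ((gr w - 1) * (gr y' - 1)).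
  move=> Rw Sy Sy'; rewrite -raddfD; apply: piX0.
  rewrite -mulrDr -mulrBr grM_sub1 gr1 mulr1 [_ + _ * _]addrC addrK.
  by apply: r_fs => //; apply: idealM_mul; exact: rel_ideal_gr.
have clabP (H : normal_subgroup F) (a : ab H) : exists2 w, H w & a = clab H w.
  exact: cls_surj.
have /choice[r1 r1P] a : exists w, R w /\ a = clab R w.
  by have [w Rw ->] := clabP _ a; exists w.
have /choice[r2 r2P] a : exists w, S w /\ a = clab S w.
  by have [w Sw ->] := clabP _ a; exists w.
(* Well defined because [R' - 1] lies in r f and [S' - 1] in f s. *)
have [b bE] : exists b : ab R -> ab S -> Y, forall w y, R w -> S y ->
    b (clab R w) (clab S y) = piX ((gr w - 1) * (gr y - 1)).
  exists (fun a c => piX ((gr (r1 a) - 1) * (gr (r2 c) - 1))) => w y Rw Sy.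
  have [Rr /esym/(cls_eq _ Rr Rw) rE] := r1P (clab R w).
  have [Sr /esym/(cls_eq _ Sr Sy) sE] := r2P (clab S y).
  rewrite -[r1 _ in LHS](mulgVK w) piD1 //; last exact: nsetF.
  rewrite [X in X + _](_ : _ = 0) ?add0r; last first.
    by rewrite -(raddf0 piX); apply: piX0; rewrite subr0; apply: rf_s => //; exact: derivedg_rf.
  rewrite -[r2 _ in LHS](mulgVK y) piD2 //; last exact: nsetF.
  rewrite [X in X + _](_ : _ = 0) ?add0r //.
  by rewrite -(raddf0 piX); apply: piX0; rewrite subr0; apply: r_fs => //; exact: derivedg_fs.
have bDl a a' c : b (a + a') c = b a c + b a' c.
  have [w Rw ->] := clabP _ a; have [w' Rw' ->] := clabP _ a'.
  have [y Sy ->] := clabP _ c; rewrite -(clabM Rw Rw').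
  by rewrite (bE _ _ (nsetM Rw Rw') Sy) (bE _ _ Rw Sy) (bE _ _ Rw' Sy) piD1.
have bDr a c c' : b a (c + c') = b a c + b a c'.
  have [w Rw ->] := clabP _ a; have [y Sy ->] := clabP _ c.
  have [y' Sy' ->] := clabP _ c'; rewrite -(clabM Sy Sy').
  by rewrite (bE _ _ Rw (nsetM Sy Sy')) (bE _ _ Rw Sy) (bE _ _ Rw Sy') piD2.
have bgE w g y : R w -> S y ->
    piX ((gr w - 1) * gr g * (gr y - 1)) = b (clab R w) (clab S y).
  move=> Rw Sy; rewrite bE //; apply: piX0; rewrite -mulrBl.
  rewrite -[X in (_ - X) * _]mulr1 -mulrBr; apply: rf_s => //.
  by apply: idealM_mul; exact: rel_ideal_gr.
have [xi xiE] : exists xi : {additive tensor (ab R) (ab S) -> Y},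
    forall a c, xi (tens a c) = b a c.
  by exists (tens_lift bDl bDr) => a c; exact: tens_liftE.
pose f x := piX (gr x - 1) - xi (tens_map q1 q2 (k x)).
have : f x = 0.
  move: x T'x {qk}; apply: commsg_add_ind => [a c T'a T'c|a c Ta Tc]; rewrite /f.
    have R'a := derived_capR T'a; have S'c := derived_capS T'c.
    have Sc := derivedg_sub S'c.
    have z0 : piX ((gr a - 1) * gr 1%g * (gr c - 1)) = 0.
      rewrite -(raddf0 piX); apply: piX0; rewrite gr1 mulr1 subr0.
      by apply: rf_s => //; exact: derivedg_rf.
    rewrite grM_sub1 2!(raddfD piX) z0 addr0.
    by rewrite k_derived // (raddfD (tens_map q1 q2)) (raddfD xi) opprD addrACA.
  have [[Ra Sa] [Rc Sc]] := (Ta, Tc).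
  rewrite kR // (raddfB (tens_map q1 q2)) /= !tens_mapE (raddfB xi) !q1E // !q2E //.
  have Rca := nsetM Rc Ra.
  have -> : piX (gr [~ a, c]%g - 1) =
      b (clab R a) (clab S c) - b (clab R c) (clab S a).
    apply: etrans (congr1 piX (grR_sub1 a c)) _; apply: etrans (raddfB piX _ _) _.
    congr (_ - _).
    - by apply: etrans (bgE _ _ _ (nsetJ _ Ra) Sc) _; rewrite (clabJ Ra Rca).
    - by apply: etrans (bgE _ _ _ (nsetJ _ Rc) Sa) _; rewrite (clabJ Rc Rca).
  by apply/eqP; rewrite subr_eq0; apply/eqP; congr (_ - _); rewrite xiE.
by rewrite /f qk raddf0 subr0 => /piXK.
Qed.

End Kappa.
End RFS.

(** * The group [P] and the isomorphism *)

Section Meet.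
Variables (F : groupType) (R S : normal_subgroup F).
Local Notation R' := (derivedg R).
Local Notation S' := (derivedg S).
Local Notation T := (capg R S).
Local Notation D := (meet_ab R S).

Fact pmeet_comm : commutative_group (subquot T (capg R' S')).
Proof. by apply: subquot_comm => x y [Rx Sx] [Ry Sy]; split; exact: mem_commsg. Qed.

Definition pmeet : zmodType := additive_of pmeet_comm.
Definition clP : F -> pmeet := cls pmeet_comm.
Definition clD : F -> D := cls (@meet_quot_comm F R S).

Lemma clPM x y : T x -> T y -> clP (x * y)%g = clP x + clP y.
Proof. exact: clsM. Qed.

Lemma clP_eq0 x : T x -> clP x = 0 <-> capg R' S' x.
Proof. exact: cls_eq0. Qed.

Lemma clP_surj a : exists2 x, T x & a = clP x.
Proof. exact: cls_surj. Qed.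

Lemma clD_surj d : exists2 x, T x & d = clD x.
Proof. exact: (@cls_surj _ _ _ (@meet_quot_comm F R S)). Qed.

Lemma clDM x y : T x -> T y -> clD (x * y)%g = clD x + clD y.
Proof. exact: clsM. Qed.

Lemma clD_eq0 x : T x -> clD x = 0 <-> meet_denom R S x.
Proof. exact: cls_eq0. Qed.

Fact pD_ex : exists p : {additive pmeet -> D}, forall x, T x -> p (clP x) = clD x.
Proof.
apply: cls_lift => [|x Tx [R'x S'x]]; first exact: clDM.
have [Rx Sx] := Tx; apply/(clD_eq0 Tx); exists x, 1%g; rewrite mulg1.
by split=> //; exact: nset1.
Qed.

Definition pD := sval (cid pD_ex).

Lemma pDE x : T x -> pD (clP x) = clD x.
Proof. by rewrite /pD; case: cid => p pE /=; exact: pE. Qed.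

Fact pR_ex : exists q : {additive pmeet -> ab R}, forall x, T x -> q (clP x) = clab R x.
Proof.
apply: cls_lift => [x y [Rx _] [Ry _]|x [Rx _] [R'x _]]; first exact: clabM.
exact/clab_eq0.
Qed.

Definition pR := sval (cid pR_ex).

Lemma pRE x : T x -> pR (clP x) = clab R x.
Proof. by rewrite /pR; case: cid => p pE /=; exact: pE. Qed.

Fact pS_ex : exists q : {additive pmeet -> ab S}, forall x, T x -> q (clP x) = clab S x.
Proof.
apply: cls_lift => [x y [_ Sx] [_ Sy]|x [_ Sx] [_ S'x]]; first exact: clabM.
exact/clab_eq0.
Qed.

Definition pS := sval (cid pS_ex).

Lemma pSE x : T x -> pS (clP x) = clab S x.
Proof. by rewrite /pS; case: cid => p pE /=; exact: pE. Qed.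

Lemma pR_eq0 x : T x -> pR (clP x) = 0 <-> R' x.
Proof. by move=> Tx; rewrite pRE //; apply: clab_eq0; case: Tx. Qed.

Lemma pS_eq0 x : T x -> pS (clP x) = 0 <-> S' x.
Proof. by move=> Tx; rewrite pSE //; apply: clab_eq0; case: Tx. Qed.

Lemma pD_surj d : exists a, pD a = d.
Proof.
by have [x Tx ->] := clD_surj d; exists (clP x); rewrite pDE.
Qed.

Lemma pRS_inj a : pR a = 0 -> pS a = 0 -> a = 0.
Proof.
have [x Tx ->] := clP_surj a.
by move=> /(pR_eq0 Tx) R'x /(pS_eq0 Tx) S'x; apply/(clP_eq0 Tx).
Qed.

Lemma pD_ker a : pD a = 0 <-> exists u v, [/\ pR u = 0, pS v = 0 & a = u + v].
Proof.
split.
  have [x Tx ->] := clP_surj a; rewrite pDE // => /(clD_eq0 Tx).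
  move=> [y [z [[R'y Sy] [Rz S'z] ->]]]; exists (clP y), (clP z).
  have Ty : T y by split=> //; exact: derivedg_sub.
  have Tz : T z by split=> //; exact: derivedg_sub.
  by split; [apply/(pR_eq0 Ty)|apply/(pS_eq0 Tz)|exact: clPM].
move=> [u [v [qu qv ->]]]; have [y Ty uE] := clP_surj u; have [z Tz vE] := clP_surj v.
move: qu qv; rewrite uE vE => /(pR_eq0 Ty) R'y /(pS_eq0 Tz) S'z.
rewrite -clPM // pDE; last exact: nsetM.
have [[Ry Sy] [Rz Sz]] := (Ty, Tz).
by apply/(clD_eq0 (nsetM Ty Tz)); exists y, z.
Qed.

Hypothesis freeF : free_group F.

Lemma pmeet_projective : projective pmeet.
Proof.
have jD : {morph (fun a => (pR a, pS a)) : a b / a + b}.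
  by move=> a b; rewrite !raddfD.
apply: (@projective_sub _ _ (addmor jD)).
  by apply: projective_prod; exact: projective_ab.
move=> a b [pab sab]; apply/eqP; rewrite -subr_eq0; apply/eqP.
by apply: pRS_inj; rewrite raddfB ?pab ?sab subrr.
Qed.

Definition kap := sval (cid (heis_lift freeF clPM)).

Lemma kapM x y : T x -> T y ->
  kap (x * y)%g = kap x + kap y + tens (clP x) (clP y).
Proof. by rewrite /kap; case: cid => k kM /=; exact: kM. Qed.

Fact clP_derived x : derivedg T x -> clP x = 0.
Proof.
move=> T'x; apply/clP_eq0; first exact: derivedg_sub.
by split; [exact: derived_capR T'x|exact: derived_capS T'x].
Qed.

Lemma kapR x y : T x -> T y ->
  kap [~ x, y]%g = tens (clP x) (clP y) - tens (clP y) (clP x).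
Proof. exact: (kR clP_derived kapM). Qed.

Lemma kap_derived x y : derivedg T x -> derivedg T y -> kap (x * y)%g = kap x + kap y.
Proof. exact: (k_derived clP_derived kapM). Qed.

Lemma kap_derivedF x y : derivedg T x -> derivedg T y -> kap (x / y)%g = kap x - kap y.
Proof.
move=> T'x T'y; apply: (addIr (kap y)); rewrite -kap_derived ?subrK ?mulgVK //.
exact: nsetF.
Qed.

Local Notation Q := (zquot (alt_rel pR pS)).
Local Notation piQ := (zpi (alt_rel pR pS)).

Lemma denom_kap w : rfs_denom R S w -> derivedg T w /\ piQ (kap w) = 0.
Proof.
pose N := [set w | derivedg T w /\ piQ (kap w) = 0].
have kap1 : kap 1%g = 0.
  by rewrite -(mulgV 1%g) kap_derivedF ?subrr //; exact: nset1.
have sN : is_subgroup N.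
  split=> [|x y [T'x x0] [T'y y0]]; first by split; [exact: nset1|rewrite kap1 raddf0].
  by split; [exact: nsetF|rewrite kap_derivedF // raddfB /= x0 y0 subrr].
have NM x y : N x -> N y -> N (x * y)%g.
  move=> Nx Ny; rewrite -[y]invgK; apply: (sN.2) => //.
  by rewrite -[(y^-1)%g]mul1g; apply: (sN.2) => //; exact: sN.1.
have R'R := @derivedg_sub _ R; have S'S := @derivedg_sub _ S.
have NR x y : T x -> T y -> piQ (tens (clP x) (clP y)) = piQ (tens (clP y) (clP x)) ->
    N [~ x, y]%g.
  move=> Tx Ty h; split; first exact: mem_commsg.
  apply: etrans (congr1 piQ (kapR Tx Ty)) _; apply: etrans (raddfB piQ _ _) _.
  by apply/eqP; rewrite subr_eq0; apply/eqP.
move=> [_ [z [[x [y [hx hy ->]]] hz ->]]]; apply: (NM); [apply: (NM)|].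
- apply: commsg_sub_ind hx => // a b [R'a S'a] [Rb Sb].
  have Ta : T a by split; [exact: R'R|exact: S'S].
  have Tb : T b by [].
  have a0 : clP a = 0 by apply/(clP_eq0 Ta); split.
  by apply: (NR _ _ Ta Tb); rewrite a0 tens0l tens0r.
- apply: commsg_sub_ind hy => // a b [R'a Sa] [R'b Sb].
  have Ta : T a by split=> //; exact: R'R.
  have Tb : T b by split=> //; exact: R'R.
  by apply: (NR _ _ Ta Tb); apply: zpi_alt1; [apply/(pR_eq0 Ta)|apply/(pR_eq0 Tb)].
- apply: commsg_sub_ind hz => // a b [Ra S'a] [Rb S'b].
  have Ta : T a by split=> //; exact: S'S.
  have Tb : T b by split=> //; exact: S'S.
  by apply: (NR _ _ Ta Tb); apply: zpi_alt2; [apply/(pS_eq0 Ta)|apply/(pS_eq0 Tb)].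
Qed.

(** The commutator, as an alternating form on [P], factors through the
    antisymmetric tensors and so recovers [w] in [T'] modulo the denominator. *)
Lemma kap_denom w : derivedg T w -> piQ (kap w) = 0 -> rfs_denom R S w.
Proof.
pose Den := rfs_denom R S.
have Den1 x : commsg (capg R' S') T x -> Den x.
  move=> hx; exists x, 1%g; rewrite mulg1; split=> //; last exact: nset1.
  by exists x, 1%g; rewrite mulg1; split=> //; exact: nset1.
have Den2 x : commsg (capg R' S) (capg R' S) x -> Den x.
  move=> hx; exists x, 1%g; rewrite mulg1; split=> //; last exact: nset1.
  by exists 1%g, x; rewrite mul1g; split=> //; exact: nset1.
have Den3 x : commsg (capg R S') (capg R S') x -> Den x.
  by move=> hx; exists 1%g, x; rewrite mul1g; split=> //; exact: nset1.
have T'W x : derivedg T x -> capg R' S' x.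
  by move=> T'x; split; [exact: derived_capR T'x|exact: derived_capS T'x].
have T'T := @derivedg_sub _ T.
(* [T'] lies in [R' cap S'], whose commutators with [T] form the first factor of the denominator.
   Hence this quotient is abelian with trivial action of [T], which makes commutators bilinear in
   it. *)
have cY : commutative_group (subquot (derivedg T) Den).
  apply: subquot_comm => x y T'x T'y; apply: Den1; apply: mem_commsg; last exact: T'T.
  exact: T'W.
have [Y [c3 c3M c3E]] : exists Y : zmodType, exists2 c3 : F -> Y,
    forall x y, derivedg T x -> derivedg T y -> c3 (x * y)%g = c3 x + c3 y &
    forall x, derivedg T x -> c3 x = 0 <-> Den x.
  by exists (additive_of cY), (cls cY); [exact: clsM|exact: cls_eq0].
have TR x y : T x -> T y -> derivedg T [~ x, y]%g by exact: mem_commsg.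
have c3J x g : derivedg T x -> T g -> c3 (x ^ g)%g = c3 x.
  move=> T'x Tg; have T'xg : derivedg T [~ x, g]%g by apply: nsetRl.
  have -> : (x ^ g = x * [~ x, g])%g by rewrite commgEl mulVKg.
  rewrite c3M // (c3E _ T'xg).2 ?addr0 //; apply: Den1; apply: mem_commsg => //.
  exact: T'W.
have c3Rl x x' y : T x -> T x' -> T y ->
    c3 [~ x * x', y]%g = c3 [~ x, y]%g + c3 [~ x', y]%g.
  move=> Tx Tx' Ty.
  have -> : ([~ x * x', y] = [~ x, y] ^ x' * [~ x', y])%g.
    by rewrite /commg /conjg !invgM !mulgA !(mulgK, mulgVK).
  have [Txy Tx'y] := (TR _ _ Tx Ty, TR _ _ Tx' Ty).
  by rewrite (c3M _ _ (nsetJ _ Txy) Tx'y) (c3J _ _ Txy Tx').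
have c31 : c3 1%g = 0.
  by apply: (addrI (c3 1%g)); rewrite -c3M ?mulg1 ?addr0 //; exact: nset1.
have c3RC x y : T x -> T y -> c3 [~ x, y]%g = - c3 [~ y, x]%g.
  move=> Tx Ty; apply: (addIr (c3 [~ y, x]%g)); rewrite addNr -c3M; [|exact: TR|exact: TR].
  by rewrite -invgR mulVg.
have c3R0 u y : capg R' S' u -> T y -> c3 [~ u, y]%g = 0.
  move=> Wu Ty; have Tu : T u by case: Wu => hR hS; split; exact: derivedg_sub.
  by apply/c3E; [exact: TR|apply: Den1; exact: mem_commsg].
have c3Rw x x' y : T x -> T x' -> T y -> clP x = clP x' ->
    c3 [~ x, y]%g = c3 [~ x', y]%g.
  move=> Tx Tx' Ty /(cls_eq pmeet_comm Tx Tx') Wxx'.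
  rewrite -[x](mulgVK x') (c3Rl _ _ _ (nsetF Tx Tx') Tx' Ty).
  by rewrite (c3R0 _ _ Wxx' Ty) add0r.
have /choice[r rP] a : exists x, T x /\ a = clP x.
  by have [x Tx ->] := clP_surj a; exists x.
(* Elements of [T] with the same [clP] differ by [R' cap S'], which commutes with [T] modulo the
   denominator. *)
have [b bE] : exists b : pmeet -> pmeet -> Y,
    forall x y, T x -> T y -> b (clP x) (clP y) = c3 [~ x, y]%g.
  exists (fun a c => c3 [~ r a, r c]%g) => x y Tx Ty.
  have [Trx rxE] := rP (clP x); have [Try ryE] := rP (clP y).
  by rewrite (c3Rw _ x) // c3RC // (c3Rw _ y) // -c3RC.
have bDl a a' c : b (a + a') c = b a c + b a' c.
  have [x Tx ->] := clP_surj a; have [x' Tx' ->] := clP_surj a'.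
  have [y Ty ->] := clP_surj c.
  by rewrite -(clPM Tx Tx') (bE _ _ (nsetM Tx Tx') Ty) (bE _ _ Tx Ty) (bE _ _ Tx' Ty) c3Rl.
have bC a c : b a c = - b c a.
  have [x Tx ->] := clP_surj a; have [y Ty ->] := clP_surj c.
  by rewrite (bE _ _ Tx Ty) (bE _ _ Ty Tx) c3RC.
have bDr a c c' : b a (c + c') = b a c + b a c'.
  by rewrite bC bDl opprD -!bC.
have b0 a : b a a = 0.
  by have [x Tx ->] := clP_surj a; rewrite (bE _ _ Tx Tx) commgg.
(* [g] recovers the class of [w] from [kap w], by comparison on commutators. It kills [alt_rel]
   because the last two factors of the denominator contain the corresponding commutators. *)
have [g gE] := alternating_split pmeet_projective bDl bDr b0.
move=> T'w kw; apply/(c3E _ T'w).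
have <- : g (kap w) = c3 w.
  apply/eqP; rewrite -subr_eq0; apply/eqP; move: (w) T'w.
  apply: (@commsg_add_ind _ _ _ _ (fun w => g (kap w) - c3 w)) => [x y T'x T'y|x y Tx Ty].
    by rewrite kap_derived // raddfD c3M // opprD addrACA.
  by rewrite kapR // raddfB /= gE (bE _ _ Tx Ty) subrr.
move: kw; rewrite -(raddf0 piQ) => /zpiP; rewrite subr0; move: (kap w).
suff h : smallest (@is_addsubgroup _) (alt_rel pR pS) `<=` [set z | g z = 0] by [].
apply: smallest_sub.
  by split=> [|x y]; rewrite /= ?raddf0 // raddfB => -> ->; rewrite subr0.
move=> _ [a [c [h ->]]] /=; rewrite raddfB /= gE; move: h.
have [x Tx ->] := clP_surj a; have [y Ty ->] := clP_surj c => h.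
rewrite (bE _ _ Tx Ty); apply/(c3E _ (TR _ _ Tx Ty)).
have [[Rx Sx] [Ry Sy]] := (Tx, Ty).
case: h => -[].
  by move=> /(pR_eq0 Tx) R'x /(pR_eq0 Ty) R'y; apply: Den2; apply: mem_commsg.
by move=> /(pS_eq0 Tx) S'x /(pS_eq0 Ty) S'y; apply: Den3; apply: mem_commsg.
Qed.

Definition PsiD : {additive L1SP2 D -> Q} := Psi pD_surj pRS_inj pD_ker.

Lemma PsiD_inj : injective PsiD.
Proof.
move=> l l' ll'; apply/eqP; rewrite -subr_eq0; apply/eqP.
apply: (@Psi_inj _ _ _ _ pD pR pS pD_surj pRS_inj pD_ker).
- exact: projective_ab.
- exact: projective_ab.
- exact: pmeet_projective.
by rewrite -[Psi _ _ _]/PsiD raddfB ll' subrr.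
Qed.

Lemma kap_sym w : derivedg T w -> zpi (@sym_rel pmeet) (kap w) = 0.
Proof.
move: w; apply: commsg_add_ind => [x y T'x T'y|x y Tx Ty].
  by rewrite kap_derived // raddfD.
by rewrite kapR //; apply: zpi_eq0; exists (clP x), (clP y).
Qed.

Lemma rfs_kap w : derivedg T w ->
  rfs_group R S w <-> tens_map pR pS (kap w) = 0.
Proof.
move=> T'w; exact: (rfs_groupP clP_derived kapM pRE pSE freeF T'w).
Qed.

Fact iso_ex (u : rfs_quot R S) : exists l, PsiD l = piQ (kap (val (repr u))).
Proof.
have rfsx := subgP (repr u); have T'x := rfs_group_derived rfsx.
apply: Psi_surj.
- exact: projective_ab.
- exact: projective_ab.
- exact: pmeet_projective.
- exact: kap_sym.
- exact/rfs_kap.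
Qed.

(** The value is unique since [PsiD] is injective; the properties of [iso] are checked after
    applying [PsiD]. *)
Definition iso u := sval (cid (iso_ex u)).

Lemma isoE (x : subg (rfs_group R S)) :
  PsiD (iso (cosetg (restrictg (rfs_group R S) (rfs_denom R S)) x)) = piQ (kap (val x)).
Proof.
rewrite /iso; case: cid => l /= ->; set y := repr _.
have : rfs_denom R S (val y / val x)%g.
  exact: (@repr_cosetg _ (restrictg (rfs_group R S) (rfs_denom R S)) x).
have T'x := rfs_group_derived (subgP x); have T'y := rfs_group_derived (subgP y).
move=> /denom_kap[_ /eqP]; rewrite kap_derivedF // raddfB subr_eq0 => /eqP.
exact.
Qed.

Lemma isoM u v : iso (u * v)%g = iso u + iso v.
Proof.
apply: PsiD_inj; rewrite raddfD -(reprgK u) -(reprgK v) -gmulfM !isoE /= -raddfD.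
congr (zpi _ _); apply: kap_derived; exact: rfs_group_derived (subgP _).
Qed.

Lemma iso_inj : injective iso.
Proof.
move=> u v /(congr1 PsiD); rewrite -(reprgK u) -(reprgK v) !isoE.
set x := repr u; set y := repr v => /eqP; rewrite -subr_eq0 -raddfB.
have T'x := rfs_group_derived (subgP x); have T'y := rfs_group_derived (subgP y).
rewrite -kap_derivedF // => /eqP kxy; apply/cosetgP; apply: kap_denom => //.
exact: nsetF.
Qed.

Lemma iso_surj l : exists u, iso u = l.
Proof.
have [z [z0 qz lz]] := Psi_im pD_surj pRS_inj pD_ker l.
(* The kernel of [P (x) P -> SP2 P] is spanned by the [a (x) b - b (x) a], each the value of [kap]
   at a commutator. *)
have [w [T'w kw]] : exists w, derivedg T w /\ kap w = z.
  move: z0; rewrite -(raddf0 (zpi (@sym_rel pmeet))) => /zpiP; rewrite subr0.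
  move: z {qz lz}; suff h : smallest (@is_addsubgroup _) (@sym_rel pmeet) `<=`
    [set z | exists w, derivedg T w /\ kap w = z] by [].
  apply: smallest_sub; first split.
  - exists 1%g; split; first exact: nset1.
    by rewrite -(mulgV 1%g) kap_derivedF ?subrr //; exact: nset1.
  - move=> _ _ [w [T'w <-]] [w' [T'w' <-]]; exists (w / w')%g.
    by split; [exact: nsetF|exact: kap_derivedF].
  - move=> _ [a [b ->]]; have [x Tx ->] := clP_surj a; have [y Ty ->] := clP_surj b.
    by exists [~ x, y]%g; split; [exact: mem_commsg|exact: kapR].
have rfsw : rfs_group R S w by apply/rfs_kap; rewrite ?kw.
exists (cosetg _ (Subg rfsw)); apply: PsiD_inj.
by rewrite isoE val_Subg kw -lz.
Qed.

Lemma iso_bij : bijective iso.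
Proof.
have /choice[g gK] := iso_surj; exists g => // u.
by apply: iso_inj; rewrite gK.
Qed.

End Meet.

(** * Naturality of the isomorphism *)

Section IsoNaturality.
Variables (F1 F2 : groupType) (phi : {multiplicative F1 -> F2}).
Variables (R1 S1 : normal_subgroup F1) (R2 S2 : normal_subgroup F2).
Hypothesis phiR : forall x, R1 x -> R2 (phi x).
Hypothesis phiS : forall x, S1 x -> S2 (phi x).
Hypotheses (freeF1 : free_group F1) (freeF2 : free_group F2).
Local Notation T1 := (capg R1 S1).
Local Notation T2 := (capg R2 S2).

Let phiT x : T1 x -> T2 (phi x) := @map_capg _ _ phi _ _ _ _ phiR phiS x.

Lemma meet_ab_mapE x : T1 x -> meet_ab_map phiR phiS (clD R1 S1 x) = clD R2 S2 (phi x).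
Proof.
move=> Tx; rewrite /clD (clsE _ Tx) (clsE _ (phiT Tx)).
apply: etrans (quotg_mapE _ _) _.
by congr (cosetg _ _); exact: val_inj.
Qed.

Lemma iso_nat (u : rfs_quot R1 S1) :
  iso freeF2 (rfs_quot_map phiR phiS u) =
  L1SP2_map (meet_ab_map phiR phiS) (iso freeF1 u).
Proof.
have [phiP phiPE] : exists g : {additive pmeet R1 S1 -> pmeet R2 S2},
    forall x, T1 x -> g (clP R1 S1 x) = clP R2 S2 (phi x).
  apply: cls_lift => [x y Tx Ty|x Tx [R'x S'x]].
    by rewrite gmulfM clPM //; exact: phiT.
  by apply/(clP_eq0 (phiT Tx)); split;
      [exact: (map_commsg phiR phiR)|exact: (map_commsg phiS phiS)].
rewrite -(reprgK u); set x := repr u.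
have T'x := rfs_group_derived (subgP x).
have -> : rfs_quot_map phiR phiS (cosetg _ x) =
    cosetg _ (subg_map (map_rfs_group phiR phiS) x) by exact: quotg_mapE.
apply: (PsiD_inj freeF2); rewrite isoE /=.
have phi_pR a : pR R1 S1 a = 0 -> pR R2 S2 (phiP a) = 0.
  have [y Ty ->] := clP_surj a; rewrite phiPE // => /(pR_eq0 Ty) R'y.
  by apply/(pR_eq0 (phiT Ty)); exact: (map_commsg phiR phiR).
have phi_pS a : pS R1 S1 a = 0 -> pS R2 S2 (phiP a) = 0.
  have [y Ty ->] := clP_surj a; rewrite phiPE // => /(pS_eq0 Ty) S'y.
  by apply/(pS_eq0 (phiT Ty)); exact: (map_commsg phiS phiS).
have phi_pD a : pD R2 S2 (phiP a) = meet_ab_map phiR phiS (pD R1 S1 a).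
  have [y Ty ->] := clP_surj a; rewrite phiPE // !pDE ?meet_ab_mapE //.
  exact: phiT.
apply: (etrans _ (esym (Psi_nat (pD_surj (S:=S2)) (pRS_inj (S:=S2)) (pD_ker (S:=S2))
  phi_pD phi_pR phi_pS (isoE freeF1 x)))).
(* The two [kap] come from unrelated choices, but on [T'] each is determined by its values on
   commutators, where the defect [f] vanishes. *)
pose f y := @kap F2 R2 S2 freeF2 (phi y) - tens_map phiP phiP (@kap F1 R1 S1 freeF1 y).
suff /(_ _ T'x)/eqP : forall y, derivedg T1 y -> f y = 0.
  by rewrite subr_eq0 => /eqP h; congr (zpi _ _).
apply: commsg_add_ind => [y z T'y T'z|y z Ty Tz]; rewrite /f.
  have phiT' v : derivedg T1 v -> derivedg T2 (phi v) by exact: (map_commsg phiT phiT).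
  rewrite gmulfM !kap_derived //; [|exact: phiT'|exact: phiT'].
  by rewrite (raddfD (tens_map phiP phiP)) opprD addrACA.
have -> : phi [~ y, z]%g = [~ phi y, phi z]%g.
  by rewrite /commg /conjg !gmulfM !Defs.mulfV.
rewrite !kapR //; [|exact: phiT|exact: phiT].
apply/eqP; rewrite subr_eq0; apply/eqP; symmetry.
apply: etrans (raddfB (tens_map phiP phiP) _ _) _.
by congr (_ - _); apply: etrans (tens_mapE _ _ _ _) _; rewrite (phiPE _ Ty) (phiPE _ Tz).
Qed.

End IsoNaturality.

Theorem theorem2p1 :
  exists iso : forall (F : groupType) (R S : normal_subgroup F),
      free_group F -> rfs_quot R S -> L1SP2 (meet_ab R S),
    (forall (F : groupType) (R S : normal_subgroup F) (freeF : free_group F),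
        bijective (iso F R S freeF) /\
        {morph iso F R S freeF : u v / (u * v)%g >-> u + v}) /\
    (forall (F1 F2 : groupType) (R1 S1 : normal_subgroup F1)
        (R2 S2 : normal_subgroup F2)
        (freeF1 : free_group F1) (freeF2 : free_group F2)
        (phi : {multiplicative F1 -> F2})
        (phiR : forall x, R1 x -> R2 (phi x))
        (phiS : forall x, S1 x -> S2 (phi x)) (u : rfs_quot R1 S1),
        iso F2 R2 S2 freeF2 (rfs_quot_map phiR phiS u) =
        L1SP2_map (meet_ab_map phiR phiS) (iso F1 R1 S1 freeF1 u)).
Proof.
exists (fun F R S freeF => @iso F R S freeF); split=> [F R S freeF|].
  by split; [exact: iso_bij|exact: isoM].
by move=> F1 F2 R1 S1 R2 S2 freeF1 freeF2 phi phiR phiS u; exact: iso_nat.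
Qed.
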